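(* Assume that $\mathbf f(0,0)=\mathbf f(\mathbf K,\mathbf K)=0$, and that $\mathbf f$ is a $C^1$ function possessing the mixed quasimonotone property in $[0,\mathbf K]$. Suppose that $\tilde\varphi,\hat\varphi\in\mathcal C_{[0,\mathbf K]}(\mathbb R,\mathbb R^n)$ are a pair of coupled upper and lower solutions of the wave equation $$\varphi'(t)-\frac{D}{c^2}\varphi''(t)=\mathbf f(\varphi(t),\varphi(t-\tau)),\quad t\in\mathbb R, \qquad (W)$$ and that $$\lim_{t\to-\infty}\tilde\varphi(t)=0,\qquad \lim_{t\to+\infty}\hat\varphi(t)=\mathbf K .$$ Then (W) together with the boundary conditions $\lim_{t\to-\infty}\varphi(t)=0$, $\lim_{t\to+\infty}\varphi(t)=\mathbf K$ admits a solution $\varphi$. That is, the system $$\frac{\partial}{\partial t}\mathbf u(x,t)-D\frac{\partial^2}{\partial x^2}\mathbf u(x,t)=\mathbf f(\mathbf u,\mathbf u_\tau),\quad x\in\mathbb R,$$ has a traveling wave solution $\mathbf u(x,t)=\varphi(t+x/c)$.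
   Context: Setting: $n\ge 1$, $D=\mathrm{diag}(d_1,\dots,d_n)$ with $d_i>0$, $c>0$ is a constant (wave speed), $\tau=(\tau_1,\dots,\tau_n)$ with positive constants $\tau_i$ (discrete delays), $\mathbf f=(f_1,\dots,f_n):\mathbb R^n\times\mathbb R^n\to\mathbb R^n$ is Lipschitz continuous, and $\mathbf K=(K_1,\dots,K_n)$ with all $K_i>0$. In the PDE, $\mathbf u_\tau(x,t)=(u_1(x,t-\tau_1),\dots,u_n(x,t-\tau_n))$. For a function $\varphi:\mathbb R\to\mathbb R^n$, $\varphi_\tau(t)=\varphi(t-\tau)=(\varphi_1(t-\tau_1),\dots,\varphi_n(t-\tau_n))$. Inequalities between vectors are componentwise. $\mathcal C_b(\mathbb R,\mathbb R^n)$ is the space of bounded continuous functions, $\mathcal C_b^k(\mathbb R,\mathbb R^n)$ the space of functions with continuous bounded derivatives up to order $k$, and $\mathcal C_{[0,\mathbf K]}(\mathbb R,\mathbb R^n)=\{\varphi\in\mathcal C_b(\mathbb R,\mathbb R^n): 0\le\varphi_i(t)\le K_i \text{ for all } t\in\mathbb R,\ i=1,\dots,n\}$. A traveling wave solution is a solution of the form $\mathbf u(x,t)=\varphi(t+x/c)$ with profile $\varphi\in\mathcal C_b^2(\mathbb R,\mathbb R^n)$ solving (W) and having limits at $\pm\infty$ (here $0$ at $-\infty$ and $\mathbf K$ at $+\infty$). Mixed quasimonotone property in $[0,\mathbf K]$: for each $i=1,\dots,n$ there exist nonnegative integers $a_i,b_i,c_i,d_i$ (here $d_i$ is an index count, not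 the diffusion coefficient) with $a_i+b_i=n-1$, $c_i+d_i=n$, and splittings $\mathbf u=(u_i,[\mathbf u]_{a_i},[\mathbf u]_{b_i})$, $\mathbf v=([\mathbf v]_{c_i},[\mathbf v]_{d_i})$ (where $[\mathbf u]_\sigma$ denotes a vector with $\sigma$ components of $\mathbf u$) such that, for arguments in $[0,\mathbf K]$, $f_i(\mathbf u,\mathbf v)=f_i(u_i,[\mathbf u]_{a_i},[\mathbf u]_{b_i},[\mathbf v]_{c_i},[\mathbf v]_{d_i})$ is nondecreasing in $[\mathbf u]_{a_i}$ and $[\mathbf v]_{c_i}$ and nonincreasing in $[\mathbf u]_{b_i}$ and $[\mathbf v]_{d_i}$. Coupled upper and lower solutions of (W): a pair $\tilde\varphi,\hat\varphi\in\mathcal C_b^2(\mathbb R,\mathbb R^n)$ with $\tilde\varphi\ge\hat\varphi$ and, for all $i=1,\dots,n$ and $t\in\mathbb R$ (with $d_i$ the diffusion coefficient on the left), $$\tilde\varphi_i'-\tfrac{d_i}{c^2}\tilde\varphi_i''\ge f_i(\tilde\varphi_i,[\tilde\varphi]_{a_i},[\hat\varphi]_{b_i},[\tilde\varphi_\tau]_{c_i},[\hat\varphi_\tau]_{d_i}),$$ $$\hat\varphi_i'-\tfrac{d_i}{c^2}\hat\varphi_i''\le f_i(\hat\varphi_i,[\hat\varphi]_{a_i},[\tilde\varphi]_{b_i},[\hat\varphi_\tau]_{c_i},[\tilde\varphi_\tau]_{d_i}).$$ *)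

(* Defs.v *)
From HB Require Import structures.
From mathcomp Require Export all_boot all_order all_algebra.
From mathcomp Require Export all_classical all_reals all_analysis.

#[global] Set Implicit Arguments.
#[global] Unset Strict Implicit.
#[global] Unset Printing Implicit Defensive.

Export Order.TTheory GRing.Theory Num.Theory.
Export numFieldNormedType.Exports.

#[global] Open Scope classical_set_scope.
#[global] Open Scope ring_scope.

(* Vectors of R^n are row vectors, so a diagonal matrix acts on the right. *)

Definition in_box (R : realType) (n : nat) (K x : 'rV[R]_n) : Prop :=
  forall i, 0 <= x 0 i <= K 0 i.

Definition Cb (R : realType) (n : nat) (phi : R -> 'rV[R]_n) : Prop :=
  continuous phi /\ bounded_fun phi.

(* The derivability clause is needed because [derive1n] is a total operator. *)
Definition Cbk (R : realType) (n k : nat) (phi : R -> 'rV[R]_n) : Prop :=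
  (forall j, (j < k)%N -> forall t, derivable (derive1n j phi) t 1) /\
  (forall j, (j <= k)%N -> Cb (derive1n j phi)).

Definition Cb_box (R : realType) (n : nat) (K : 'rV[R]_n)
    (phi : R -> 'rV[R]_n) : Prop :=
  Cb phi /\ forall t, in_box K (phi t).

(* In finite dimension, continuity of z |-> 'd f z for the operator norm is
   continuity of z |-> 'd f z v for every v. *)
Definition C1 (R : realType) (V W : normedModType R) (f : V -> W) : Prop :=
  (forall z, differentiable f z) /\ (forall v, continuous (fun z => 'd f z v)).

Definition delay (R : realType) (n : nat) (tau : 'rV[R]_n)
    (phi : R -> 'rV[R]_n) (t : R) : 'rV[R]_n :=
  \row_j phi (t - tau 0 j) 0 j.

(* The index sets of the blocks [u]_{a_i}, [u]_{b_i}, [v]_{c_i}, [v]_{d_i}; the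
   counts a_i, b_i, c_i, d_i are their cardinals, so that a_i + b_i = n - 1 and
   c_i + d_i = n. *)
Record splitting (n : nat) := Splitting {
  ublock_inc : 'I_n -> {set 'I_n};
  ublock_dec : 'I_n -> {set 'I_n};
  vblock_inc : 'I_n -> {set 'I_n};
  vblock_dec : 'I_n -> {set 'I_n};
  ublock_disjoint : forall i, ublock_inc i :&: ublock_dec i = finset.set0;
  ublock_cover : forall i j,
    ((j \in ublock_inc i) || (j \in ublock_dec i)) = (j != i);
  vblock_disjoint : forall i, vblock_inc i :&: vblock_dec i = finset.set0;
  vblock_cover : forall i j, (j \in vblock_inc i) || (j \in vblock_dec i)
}.

Definition le_block (R : realType) (n : nat) (S : {set 'I_n})
    (x y : 'rV[R]_n) : Prop :=
  (forall j, j \in S -> x 0 j <= y 0 j) /\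
  (forall j, j \notin S -> x 0 j = y 0 j).

Definition mixed_quasimonotone (R : realType) (n : nat) (K : 'rV[R]_n)
    (f : 'rV[R]_n * 'rV[R]_n -> 'rV[R]_n) (s : splitting n) : Prop :=
  forall i,
    [/\ forall u u' v, in_box K u -> in_box K u' -> in_box K v ->
          le_block (ublock_inc s i) u u' -> f (u, v) 0 i <= f (u', v) 0 i,
        forall u u' v, in_box K u -> in_box K u' -> in_box K v ->
          le_block (ublock_dec s i) u u' -> f (u', v) 0 i <= f (u, v) 0 i,
        forall u v v', in_box K u -> in_box K v -> in_box K v' ->
          le_block (vblock_inc s i) v v' -> f (u, v) 0 i <= f (u, v') 0 i
      & forall u v v', in_box K u -> in_box K v -> in_box K v' ->
          le_block (vblock_dec s i) v v' -> f (u, v') 0 i <= f (u, v) 0 i].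

(* The vector whose components are those of y on S and those of x off S. *)
Definition override (R : realType) (n : nat) (S : {set 'I_n})
    (x y : 'rV[R]_n) : 'rV[R]_n :=
  \row_j (if j \in S then y 0 j else x 0 j).

Definition coupled_upper_lower (R : realType) (n : nat) (d : 'rV[R]_n) (c : R)
    (tau : 'rV[R]_n) (f : 'rV[R]_n * 'rV[R]_n -> 'rV[R]_n) (s : splitting n)
    (up lo : R -> 'rV[R]_n) : Prop :=
  [/\ Cbk 2 up, Cbk 2 lo,
      forall t i, lo t 0 i <= up t 0 i,
      forall i t,
        f (override (ublock_dec s i) (up t) (lo t),
           override (vblock_dec s i) (delay tau up t) (delay tau lo t)) 0 i
        <= (derive1 up t) 0 i - d 0 i / c ^+ 2 * (derive1n 2 up t) 0 i
    & forall i t,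
        (derive1 lo t) 0 i - d 0 i / c ^+ 2 * (derive1n 2 lo t) 0 i <=
        f (override (ublock_dec s i) (lo t) (up t),
           override (vblock_dec s i) (delay tau lo t) (delay tau up t)) 0 i].

Definition wave_equation (R : realType) (n : nat) (d : 'rV[R]_n) (c : R)
    (tau : 'rV[R]_n) (f : 'rV[R]_n * 'rV[R]_n -> 'rV[R]_n)
    (phi : R -> 'rV[R]_n) : Prop :=
  forall t, derive1 phi t - derive1n 2 phi t *m ((c ^+ 2)^-1 *: diag_mx d) =
            f (phi t, delay tau phi t).

(* u is a function of x and t, in this order. *)
Definition pde_solution (R : realType) (n : nat) (d tau : 'rV[R]_n)
    (f : 'rV[R]_n * 'rV[R]_n -> 'rV[R]_n) (u : R -> R -> 'rV[R]_n) : Prop :=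
  forall x t,
    [/\ derivable (u x) t 1,
        derivable (u^~ t) x 1,
        derivable (derive1 (u^~ t)) x 1
      & derive1 (u x) t - derive1n 2 (u^~ t) x *m diag_mx d =
        f (u x t, delay tau (u x) t)].

Definition traveling_wave_profile (R : realType) (n : nat) (d : 'rV[R]_n)
    (c : R) (tau : 'rV[R]_n) (f : 'rV[R]_n * 'rV[R]_n -> 'rV[R]_n)
    (K : 'rV[R]_n) (phi : R -> 'rV[R]_n) : Prop :=
  [/\ Cbk 2 phi, wave_equation d c tau f phi,
      phi t @[t --> -oo] --> (0 : 'rV[R]_n) & phi t @[t --> +oo] --> K].

(* Main.v *)
Require Import Defs.
From mathcomp Require Import ring lra.

(** A constant [beta i] added on both sides turns the [i]-th equation, with
    [D i = d i / c ^ 2], into [y' - D y'' + beta y = f_i + beta phi_i], whose left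
    side factors as [- D (d/dt + mu) (d/dt - nu) y].  Hence a bounded continuous
    right side has a unique bounded solution, depending monotonically on it
    ([elliptic_solve], [elliptic_ge0]).  A profile is thus a fixed point of the map
    sending [psi] to the solution for the right side built from [psi].  Once [beta]
    exceeds the Lipschitz constant of [f], the differential inequalities for the
    coupled upper and lower solutions and mixed quasimonotonicity imply that this
    map sends functions between [lo] and [up] to functions between [lo] and
    [up] ([source_between], [solves_between]).  Truncating [psi] to the strip
    between [lo] and [up] makes the map defined everywhere, and a fixed point is
    automatically in the strip.

    The map is not monotone, since [f] may decrease in some arguments, so iteration
    from [up] and [lo] only gives a pair of coupled quasi-solutions; a topological
    fixed point theorem is used instead.  It comes in three steps.

    - Combinatorics: for labels in F_2 on the vertices of a cubical grid, the
      [i]-th label being 0 on the face [x_i = 0] and 1 on the face [x_i = p], some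
      cell carries both values of every label ([kuhn_cubical]).  The sum over all
      cells of the cup product of the coboundaries of the labels telescopes to 1,
      and a nonzero summand is such a cell.
    - It follows that a Lipschitz self-map of a finite-dimensional cube has
      approximate fixed points ([approx_fixed_point]).  The map above is reduced to
      such a self-map by sampling functions at finitely many times and
      reconstructing them by a Lipschitz interpolation ([approx_solution]).
    - Along finer and finer samplings, the approximate solutions, their
      derivatives and their second derivatives are bounded and uniformly Lipschitz.
      Pointwise limits along an ultrafilter therefore exist and commute with
      differentiation ([lipschitz_derive_limit]), and the limit is a fixed point
      ([profile_between_exists]).

    Since [0 <= lo <= phi <= up <= K], the limits at both infinities follow by
    squeezing. *)

(** * A cubical form of Sperner's lemma *)

Section Kuhn.
Variables (J : finType) (a : J -> (J -> nat) -> 'F_2).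
Implicit Types (x y q : J -> nat) (i j : J) (A : {set J}) (l s : seq J).

Definition step_up i x : J -> nat := fun j => (x j + (j == i))%N.
Definition set_coord i k x : J -> nat := fun j => if j == i then k else x j.

(** The cup product of the coboundaries of the labels [a i], for [i] in [l], on the
    cube with lowest vertex [x] and edge directions [A]: a sum over monotone edge
    paths from the lowest to the highest vertex of products of label increments.
    Coefficients in F_2 make signs and orientations unnecessary. *)
Fixpoint cup l A x : 'F_2 :=
  if l is i :: l' then
    \sum_(j in A) (a i (step_up j x) - a i x) * cup l' (A :\ j) (step_up j x)
  else 1.

Lemma step_upC i j x : step_up i (step_up j x) = step_up j (step_up i x).
Proof. by apply/funext => k; rewrite /step_up addnAC. Qed.

Lemma setD1C A i j : (A :\ i) :\ j = (A :\ j) :\ i.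
Proof. by rewrite !finset.setDDl finset.setUC. Qed.

Lemma sum_setD1C A (F : J -> J -> 'F_2) :
  \sum_(i in A) \sum_(j in A :\ i) F i j = \sum_(j in A) \sum_(i in A :\ j) F i j.
Proof.
rewrite (exchange_big_dep (mem A)) /=; last by move=> i j _; rewrite !inE => /andP[].
apply: eq_bigr => j jA; apply: eq_bigl => i; rewrite !inE jA andbT eq_sym.
by rewrite andbC.
Qed.

Lemma F2_addrr (z : 'F_2) : z + z = 0.
Proof. by rewrite addrr_pchar2 // pchar_Fp. Qed.

Lemma F2_oppr (z : 'F_2) : - z = z.
Proof. by rewrite oppr_pchar2 // pchar_Fp. Qed.

(** The terms [F i j] and [F j i] cancel in pairs modulo 2. *)
Lemma sum_setD1_sym A (F : J -> J -> 'F_2) : (forall i j, F i j = F j i) ->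
  \sum_(i in A) \sum_(j in A :\ i) F i j = 0.
Proof.
move=> Fsym; pose lt i j := (enum_rank i < enum_rank j)%N.
have split_lt i : \sum_(j in A :\ i) F i j =
    \sum_(j in A | lt i j) F i j + \sum_(j in A | lt j i) F i j.
  rewrite (bigID (lt i)) /=; congr (_ + _); apply: eq_bigl => j; rewrite !inE /lt.
    by case: (eqVneq j i) => [->|]; rewrite ?ltnn ?andbF.
  rewrite -leqNgt leq_eqVlt val_eqE (can_eq enum_rankK).
  by case: (eqVneq j i) => [->|]; rewrite ?ltnn ?andbF.
under eq_bigr do rewrite split_lt.
rewrite big_split /= (exchange_big_dep (mem A)) /=; last by move=> i j _ /andP[].
rewrite -big_split big1 //= => i iA.
rewrite (eq_bigl (fun j => (j \in A) && lt j i)) => [|j]; last by rewrite iA.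
by under eq_bigr do rewrite Fsym; exact: F2_addrr.
Qed.

(** The cup product of coboundaries is closed: its sum over the faces of a cube of
    one more dimension vanishes, here with the upper faces on the left and the
    lower faces on the right.  Expanding the first factor, the terms carrying the
    label at a vertex two steps away from [x] cancel by symmetry; the others are
    instances of closedness for the remaining factors. *)
Lemma cup_closed l A x : #|A| = (size l).+1 ->
  \sum_(j in A) cup l (A :\ j) (step_up j x) = \sum_(j in A) cup l (A :\ j) x.
Proof.
elim: l A x => [//|i l IH] A x cardA /=.
have cardD j : j \in A -> #|A :\ j| = (size l).+1.
  by move=> jA; move: cardA; rewrite (cardsD1 j) jA => -[].
have lhs : \sum_(j in A) \sum_(k in A :\ j)
    (a i (step_up k (step_up j x)) - a i (step_up j x)) *
    cup l ((A :\ j) :\ k) (step_up k (step_up j x)) =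
    \sum_(j in A) \sum_(k in A :\ j)
      a i (step_up j x) * cup l ((A :\ j) :\ k) (step_up j x).
  under eq_bigr do (under eq_bigr do rewrite mulrBl; rewrite sumrB).
  rewrite sumrB sum_setD1_sym; last by move=> j k; rewrite step_upC setD1C.
  rewrite sub0r F2_oppr; apply: eq_bigr => j jA.
  by rewrite -!mulr_sumr IH ?cardD.
have rhs : \sum_(j in A) \sum_(k in A :\ j)
    a i x * cup l ((A :\ j) :\ k) (step_up k x) = 0.
  rewrite (eq_bigr (fun j => \sum_(k in A :\ j) a i x * cup l ((A :\ j) :\ k) x)).
    by apply: sum_setD1_sym => j k; rewrite setD1C.
  by move=> j jA; rewrite -!mulr_sumr IH ?cardD.
rewrite lhs.
under [RHS]eq_bigr do (under eq_bigr do rewrite mulrBl; rewrite sumrB).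
rewrite sumrB rhs subr0 sum_setD1C; apply: eq_bigr => j jA.
by apply: eq_bigr => k kA; rewrite setD1C.
Qed.

(** A label constant on a face contributes a zero increment to every path inside
    that face. *)
Lemma cup_face0 l A x i : i \in l -> i \notin A ->
  (forall y z, y i = x i -> z i = x i -> a i y = a i z) -> cup l A x = 0.
Proof.
elim: l A x => [//|k l IH] A x; rewrite inE => /orP[/eqP <-|il] iA const /=;
  apply: big1 => j jA; have ij : (i == j) = false by apply: contraNF iA => /eqP ->.
  by rewrite (const (step_up j x) x) ?subrr ?mul0r // /step_up ij addn0.
have bx : step_up j x i = x i by rewrite /step_up ij addn0.
by rewrite IH ?mulr0 // ?bx // !inE negb_and iA orbT.
Qed.

Lemma cup_neq0 l A x i : cup l A x != 0 -> i \in l ->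
  exists y z, [/\ a i y != a i z, forall j, (x j <= y j <= (x j).+1)%N
                & forall j, (x j <= z j <= (x j).+1)%N].
Proof.
suff cell : forall A x, cup l A x != 0 -> i \in l ->
    exists y z, [/\ a i y != a i z, forall j, (x j <= y j <= x j + (j \in A))%N
                & forall j, (x j <= z j <= x j + (j \in A))%N].
  move=> nz il; have [y [z [yz hy hz]]] := cell A x nz il.
  exists y, z; split => // j.
    by have := hy j; case: (j \in A) => /andP[-> h]; rewrite (leq_trans h)// ?addn0 ?addn1.
  by have := hz j; case: (j \in A) => /andP[-> h]; rewrite (leq_trans h)// ?addn0 ?addn1.
elim: l => [//|k l IH] {}A {}x /= nz.
have [j jA] : exists2 j, j \in A &
    (a k (step_up j x) - a k x) * cup l (A :\ j) (step_up j x) != 0.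
  apply/exists_inP; apply: contraNT nz => /exists_inPn h; apply/eqP/big1 => j jA.
  by apply/eqP; have := h j jA; rewrite negbK.
rewrite mulf_eq0 negb_or => /andP[nza nzc]; rewrite inE => /orP[/eqP ->|il].
  exists (step_up j x), x; split=> [|m|m]; first by rewrite -subr_eq0.
    by rewrite /step_up leq_addr leq_add2l /=; case: eqVneq => // ->; rewrite jA.
  by rewrite leqnn leq_addr.
have [y [z [yz hy hz]]] := IH _ _ nzc il.
have weak m u : (step_up j x m <= u <= step_up j x m + (m \in A :\ j))%N ->
    (x m <= u <= x m + (m \in A))%N.
  rewrite /step_up !inE; case: (eqVneq m j) => [->|_] /=; last by rewrite addn0.
  by rewrite jA addn0 => /andP[/(leq_trans (leq_addr _ _)) -> ->].
by exists y, z; split => // m; apply: weak.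
Qed.

(** The sum over a grid is an iterated sum over the coordinates listed in [s], the
    others being frozen, so that telescoping in one direction is the telescoping of
    one of the nested sums. *)
Section boxsum.
Variable p : nat.

Fixpoint boxsum s (F : (J -> nat) -> 'F_2) x : 'F_2 :=
  if s is i :: s' then \sum_(k < p) boxsum s' F (set_coord i k x) else F x.

Lemma boxsum_eq s F G x :
  (forall y, (forall j, j \notin s -> y j = x j) -> F y = G y) ->
  boxsum s F x = boxsum s G x.
Proof.
elim: s x => [|i s IH] x FG /=; first exact: FG.
apply: eq_bigr => k _; apply: IH => y hy; apply: FG => j.
rewrite inE negb_or => /andP[ji js]; rewrite hy // /set_coord.
by rewrite (negbTE ji).
Qed.

Lemma boxsumD s F G x :
  boxsum s (fun y => F y + G y) x = boxsum s F x + boxsum s G x.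
Proof.
elim: s x => [//|i s IH] x /=; rewrite -big_split /=.
by apply: eq_bigr => k _; rewrite IH.
Qed.

Lemma boxsum0 s x : boxsum s (fun=> 0) x = 0.
Proof. by elim: s x => [//|i s IH] x /=; apply: big1. Qed.

Lemma boxsum_sum (I : finType) (P : pred I) s (F : I -> (J -> nat) -> 'F_2) x :
  boxsum s (fun y => \sum_(i | P i) F i y) x = \sum_(i | P i) boxsum s (F i) x.
Proof.
elim: s x => [//|i s IH] x /=; rewrite exchange_big /=.
by apply: eq_bigr => k _; rewrite IH.
Qed.

Lemma boxsum_step_up s F x j : j \notin s ->
  boxsum s (fun y => F (step_up j y)) x = boxsum s F (step_up j x).
Proof.
elim: s x => [//|i s IH] x /=; rewrite inE negb_or => /andP[ji js].
apply: eq_bigr => k _; rewrite IH //; congr boxsum; apply/funext => m.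
rewrite /step_up /set_coord; case: (eqVneq m i) => // ->.
by rewrite eq_sym (negbTE ji) addn0.
Qed.

Lemma boxsum_telescope s F x j : uniq s -> j \in s ->
  boxsum s (fun y => F (step_up j y) - F y) x =
  boxsum (rem j s) F (set_coord j p x) - boxsum (rem j s) F (set_coord j 0 x).
Proof.
elim: s x => [//|i s IH] x /= /andP[nis us]; rewrite inE.
case: (eqVneq j i) => [->|ji /= js].
  move=> _.
  pose S (k : nat) := boxsum s F (set_coord i k x).
  rewrite -[RHS](telescope_sumr S (leq0n p)) big_mkord; apply: eq_bigr => k _.
  rewrite boxsumD boxsum_step_up // /S F2_oppr.
  have -> : boxsum s (fun y => - F y) (set_coord i k x) = boxsum s F (set_coord i k x).
    by apply: boxsum_eq => y _; rewrite F2_oppr.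
  congr (boxsum s F _ + _); apply/funext => m; rewrite /step_up /set_coord.
  by case: eqVneq => // _; rewrite ?addn1 ?addn0.
rewrite /= -sumrB; apply: eq_bigr => k _; rewrite IH //.
by congr (boxsum _ _ _ - boxsum _ _ _); apply/funext => m; rewrite /set_coord;
  case: (eqVneq m j) => [->|//]; rewrite (negbTE ji).
Qed.

Lemma boxsum_neq0 s F x : boxsum s F x != 0 ->
  exists y, [/\ F y != 0, forall j, j \in s -> (y j < p)%N
              & forall j, j \notin s -> y j = x j].
Proof.
elim: s x => [|i s IH] x /= nz; first by exists x.
have [k nzk] : exists k : 'I_p, boxsum s F (set_coord i k x) != 0.
  apply/existsP; apply: contraNT nz; rewrite negb_exists => /forallP h.
  by apply/eqP/big1 => k _; apply/eqP; have := h k; rewrite negbK.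
have [y [Fy yp yx]] := IH _ nzk; exists y; split => // j; rewrite inE.
  case/orP => [/eqP ->|/yp //]; case: (boolP (i \in s)) => [/yp //|/yx ->].
  by rewrite /set_coord eqxx.
by rewrite negb_or => /andP[ji /yx ->]; rewrite /set_coord (negbTE ji).
Qed.

Hypothesis a0 : forall i x, x i = 0%N -> a i x = 0.
Hypothesis ap : forall i x, x i = p -> a i x = 1.

(** By closedness the summand is the sum over the directions [j] of the increments
    in direction [j] of [a i * cup l], so the sum telescopes to the boundary faces.
    On the faces orthogonal to a direction [j] other than [i], the label [a j] is
    constant and the cup product vanishes; on the face [x_i = 0] the factor [a i]
    is zero; on the face [x_i = p] it is one, which leaves the same sum in one
    dimension less. *)
Lemma boxsum_cup l x : uniq l -> boxsum l (cup l [set j in l]) x = 1.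
Proof.
elim: l x => [//|i l IH] x ul; move: (ul) => /andP[il uqn_l].
set A := [set j in i :: l].
have cardA : #|A| = (size l).+1 by rewrite cardsE (card_uniqP ul).
pose G j y := a i y * cup l (A :\ j) y.
rewrite (@boxsum_eq _ _ (fun y => \sum_(j in A) (G j (step_up j y) - G j y))); last first.
  move=> y _ /=; rewrite sumrB -[in RHS]mulr_sumr -cup_closed // mulr_sumr -sumrB.
  by apply: eq_bigr => j _; rewrite mulrBl.
rewrite (boxsum_sum (fun j => j \in A) _ (fun j y => G j (step_up j y) - G j y)).
rewrite (eq_bigr (fun j => boxsum (rem j (i :: l)) (G j) (set_coord j p x) -
  boxsum (rem j (i :: l)) (G j) (set_coord j 0 x))); last first.
  by move=> j; rewrite inE => jil; exact: boxsum_telescope.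
rewrite (bigD1 i) /=; last by rewrite !inE eqxx.
have Ai : A :\ i = [set j in l].
  apply/setP => j; rewrite !inE; case: (eqVneq j i) => [->|//].
  by rewrite (negbTE il).
rewrite eqxx (@boxsum_eq _ _ (cup l [set j in l])) ?IH //; last first.
  by move=> y hy; rewrite /G Ai ap ?mul1r // hy // /set_coord eqxx.
rewrite (@boxsum_eq _ (G i) (fun=> 0)) ?boxsum0; last first.
  by move=> y hy; rewrite /G a0 ?mul0r // hy // /set_coord eqxx.
rewrite subr0 big1 ?addr0 // => j /andP[]; rewrite inE => jil ji.
have jl : j \in l by move: jil; rewrite inE (negbTE ji).
have jr : j \notin rem j (i :: l) by rewrite mem_rem_uniqF.
rewrite !(@boxsum_eq _ (G j) (fun=> 0)) ?boxsum0 ?subrr // => y hy.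
  rewrite /G (@cup_face0 _ _ _ j) ?mulr0 ?inE ?eqxx // => u v.
  by rewrite hy // /set_coord eqxx => u0 v0; rewrite !a0.
rewrite /G (@cup_face0 _ _ _ j) ?mulr0 ?inE ?eqxx // => u v.
by rewrite hy // /set_coord eqxx => u0 v0; rewrite !ap.
Qed.

Lemma kuhn_cubical : exists q, (forall j, (q j < p)%N) /\
  forall i, exists y z, [/\ a i y != a i z, forall j, (q j <= y j <= (q j).+1)%N
                & forall j, (q j <= z j <= (q j).+1)%N].
Proof.
have : boxsum (enum J) (cup (enum J) [set j in enum J]) (fun=> 0%N) != 0.
  by rewrite boxsum_cup ?enum_uniq ?oner_neq0.
case/boxsum_neq0 => q [nz qp _]; exists q; split=> [j|i].
  by apply: qp; rewrite mem_enum.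
by apply: (cup_neq0 nz); rewrite mem_enum.
Qed.

End boxsum.
End Kuhn.

(** * Approximate fixed points in a cube *)

(** Label a grid point by the direction of the displacement: the [i]-th label says
    whether [G] does not increase the [i]-th coordinate.  In a cell where every
    label takes both values, each coordinate of the displacement is nonpositive at
    one vertex and nonnegative at another, hence small throughout by the Lipschitz
    bound. *)
Lemma approx_fixed_point (R : realType) (J : finType) (B L : R)
    (G : (J -> R) -> J -> R) : 0 < B -> 0 <= L ->
  (forall x : J -> R, (forall j, 0 <= x j <= B) -> forall j, 0 <= G x j <= B) ->
  (forall (x y : J -> R) (h : R), (forall j, 0 <= x j <= B) -> (forall j, 0 <= y j <= B) ->
    (forall j, `|x j - y j| <= h) -> forall j, `|G x j - G y j| <= L * h) ->
  forall e : R, 0 < e ->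
  exists x : J -> R, (forall j, 0 <= x j <= B) /\ (forall j, `|G x j - x j| <= e).
Proof.
move=> B0 L0 Gbox Glip e e0.
(* The mesh [h = B / p] is such that [(L + 1) * h <= e]. *)
pose p := (Num.truncn ((L + 1) * B / e)).+1.
have p0 : 0 < p%:R :> R by rewrite ltr0n.
pose h := B / p%:R.
have h0 : 0 < h by rewrite divr_gt0.
have he : (L + 1) * h <= e.
  rewrite mulrA ler_pdivrMr // [leRHS]mulrC -ler_pdivrMr //.
  exact/ltW/truncnS_gt.
pose g (y : J -> nat) j := h * (y j)%:R.
(* The values on the two faces are forced; they agree with the sign of the
   displacement because [G] maps the cube to itself. *)
pose a i (y : J -> nat) : 'F_2 :=
  if y i == 0%N then 0 else if y i == p then 1 else ((G (g y) i <= g y i)%R : nat)%:R.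
have gbox y : (forall j, (y j <= p)%N) -> forall j, 0 <= g y j <= B.
  move=> yp j; rewrite mulr_ge0 ?ler0n ?(ltW h0) //=.
  have -> : B = h * p%:R by rewrite divfK ?gt_eqF.
  by rewrite ler_pM2l // ler_nat.
have a01 i y : (forall j, (y j <= p)%N) ->
    (a i y = 1 /\ G (g y) i <= g y i) \/ (a i y = 0 /\ g y i <= G (g y) i).
  move=> yp; have /andP[G0 GB] := Gbox _ (gbox _ yp) i; rewrite /a.
  case: eqP => [y0|_]; first by right; rewrite {1}/g y0 mulr0.
  case: eqP => [yip|_].
    by left; rewrite {2}/g yip divfK ?gt_eqF.
  by case: leP => hG; [left | right; split => //; exact: ltW].
have [||q [qp hq]] := @kuhn_cubical J a p.
- by move=> i y /eqP y0; rewrite /a y0.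
- by move=> i y /eqP yp; rewrite /a yp; case: eqP => // y0; move: yp; rewrite y0.
have cellp y : (forall j, (q j <= y j <= (q j).+1)%N) -> forall j, (y j <= p)%N.
  by move=> hy j; have /andP[_ /leq_trans] := hy j; apply; exact: qp.
have qle j : (q j <= p)%N by exact/ltnW/qp.
have near_q y : (forall j, (q j <= y j <= (q j).+1)%N) -> forall j, `|g q j - g y j| <= h.
  move=> hy j; rewrite -mulrBr normrM gtr0_norm // ger_pMr //.
  have /andP[h1 h2] := hy j; rewrite distrC -natrB // normr_nat lern1.
  by rewrite leq_subLR addn1.
exists (g q); split => [|i]; first exact: gbox.
have [y [z [ayz hy hz]]] := hq i.
wlog [ay1 az0] : y z ayz hy hz / a i y = 1 /\ a i z = 0.
  move=> H; case: (a01 i y (cellp _ hy)) (a01 i z (cellp _ hz)) =>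
    [[y1 _]|[y0 _]] [[z1 _]|[z0 _]].
  - by move: ayz; rewrite y1 z1 eqxx.
  - exact: (H y z).
  - by apply: (H z y) => //; rewrite eq_sym.
  - by move: ayz; rewrite y0 z0 eqxx.
have [[_ hGy]|[]] := a01 i y (cellp _ hy); last by rewrite ay1 => /eqP; rewrite oner_eq0.
have [[]|[_ hGz]] := a01 i z (cellp _ hz); first by rewrite az0 => /esym/eqP; rewrite oner_eq0.
have := Glip _ _ h (gbox _ qle) (gbox _ (cellp _ hy)) (near_q _ hy) i.
have := Glip _ _ h (gbox _ qle) (gbox _ (cellp _ hz)) (near_q _ hz) i.
have := near_q _ hy i; have := near_q _ hz i; move: he.
rewrite !ler_norml => ? /andP[? ?] /andP[? ?] /andP[? ?] /andP[? ?].
by apply/andP; split; lra.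
Qed.

(** * Linear equations on the whole line *)

Section Analysis.
Variable R : realType.
Implicit Types (f g y : R -> R) (s t : R).

(** The usual rules, with the sum, product, etc. written as a pointwise lambda
    abstraction so that they apply to goals of that form. *)
Lemma is_deriveD_fun f g t (df dg : R) : is_derive t 1 f df -> is_derive t 1 g dg ->
  is_derive t 1 (fun s => f s + g s) (df + dg).
Proof. by move=> hf hg; exact: (is_deriveD hf hg). Qed.

Lemma is_deriveB_fun f g t (df dg : R) : is_derive t 1 f df -> is_derive t 1 g dg ->
  is_derive t 1 (fun s => f s - g s) (df - dg).
Proof. by move=> hf hg; exact: (is_deriveB hf hg). Qed.

Lemma is_deriveN_fun f t (df : R) : is_derive t 1 f df ->
  is_derive t 1 (fun s => - f s) (- df).
Proof. by move=> hf; exact: (is_deriveN hf). Qed.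

Lemma is_deriveZ_fun f t (k df : R) : is_derive t 1 f df ->
  is_derive t 1 (fun s => k * f s) (k * df).
Proof. by move=> hf; exact: (is_deriveZ k hf). Qed.

Lemma is_deriveM_fun f g t (df dg : R) : is_derive t 1 f df -> is_derive t 1 g dg ->
  is_derive t 1 (fun s => f s * g s) (df * g t + f t * dg).
Proof.
move=> hf hg; have h := is_deriveM hf hg.
have -> : df * g t + f t * dg = f t *: dg + g t *: df.
  by rewrite /GRing.scale /= addrC (mulrC df).
exact: h.
Qed.

Lemma integral_antiderivative f (N : R) (x u : R) : continuous f -> - N < x -> x < u ->
  is_derive x 1 (fun t : R => \int[lebesgue_measure]_(s in `[- N, t]) f s)%R (f x).
Proof.
move=> cf Nx xu.
have intf : lebesgue_measure.-integrable `[- N, u] (EFin \o f).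
  apply: continuous_compact_integrable; first exact: segment_compact.
  exact: continuous_subspaceT.
have [d1 d2] := continuous_FTC1_closed xu intf Nx (cf x).
by apply: DeriveDef => //; rewrite -derive1E.
Qed.

Lemma derive_ge0_nondecreasing_gt a f f' :
  (forall t : R, a < t -> is_derive t 1 f (f' t)) ->
  (forall t, a < t -> 0 <= f' t) -> forall s t, a < s -> s <= t -> f s <= f t.
Proof.
move=> df f0 s t sa st.
apply: (ger0_derive1_le_cc (a := s) (b := t)) => // [x|x|||].
- by rewrite in_itv /= => /andP[sx _]; have [] := df x (lt_trans sa sx).
- rewrite in_itv /= => /andP[sx _]; have ax := lt_trans sa sx.
  by rewrite derive1E; have [_ ->] := df x ax; exact: f0.
- apply: derivable_within_continuous => x.
  by rewrite in_itv /= => /andP[sx _]; have [] := df x (lt_le_trans sa sx).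
- by rewrite in_itv /= lexx.
- by rewrite in_itv /= lexx st.
Qed.

Lemma derive_ge0_nondecreasing f f' : (forall t : R, is_derive t 1 f (f' t)) ->
  (forall t, 0 <= f' t) -> {homo f : s t / s <= t}.
Proof.
move=> df f0 s t; apply: (@derive_ge0_nondecreasing_gt (s - 1) f f') => //.
by rewrite ltrBlDr ltrDl.
Qed.

Lemma derive0_constant_gt a f : (forall t : R, a < t -> is_derive t 1 f 0) ->
  forall s t, a < s -> a < t -> f s = f t.
Proof.
move=> df; suff le s t : a < s -> s <= t -> f s = f t.
  by move=> s t sa ta; case: (leP s t) => [/le ->//|/ltW/le ->].
move=> sa st; apply/eqP; rewrite eq_le.
rewrite (@derive_ge0_nondecreasing_gt a f (fun=> 0)) //= -lerN2.
apply: (@derive_ge0_nondecreasing_gt a (- f) (fun=> 0)) => // z za.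
by rewrite -[X in is_derive _ _ _ X]oppr0; apply: is_deriveN; exact: df.
Qed.

(** Integrals from [- N] are antiderivatives on the half-line beyond [- N]; after
    subtracting their value at 0 they agree on common domains, and glue. *)
Lemma antiderivative f : continuous f ->
  exists F : R -> R, forall t : R, is_derive t 1 F (f t).
Proof.
move=> cf.
pose I (N : nat) (t : R) := (\int[lebesgue_measure]_(s in `[- N%:R, t]) f s)%R.
pose A (N : nat) (t : R) := I N t - I N 0.
have dA N (t : R) : - N%:R < t -> is_derive t 1 (A N) (f t).
  move=> Nt; have dI := @integral_antiderivative f N%:R t (t + 1) cf Nt.
  have {}dI : is_derive t 1 (I N) (f t) by apply: dI; rewrite ltrDl.
  rewrite -[f t]subr0; apply: is_deriveB.
pose idx (t : R) := (Num.truncn `|t|).+1.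
have idxP t : - (idx t)%:R < t.
  by rewrite ltrNl (le_lt_trans (ler_norm _)) // normrN truncnS_gt.
have A_agree N M (t : R) : (0 < N)%N -> (0 < M)%N -> - N%:R < t -> - M%:R < t -> A N t = A M t.
  move=> N0 M0 Nt Mt; apply/eqP; rewrite -subr_eq0; apply/eqP.
  have A0 K : A K 0 = 0 by rewrite /A subrr.
  rewrite [RHS](_ : _ = A N 0 - A M 0); last by rewrite !A0 subrr.
  pose a : R := Num.max (- N%:R) (- M%:R).
  apply: (@derive0_constant_gt a (fun t => A N t - A M t)).
  - move=> z; rewrite gt_max => /andP[Nz Mz].
    by rewrite -(subrr (f z)); apply: is_deriveB; exact: dA.
  - by rewrite gt_max Nt.
  - by rewrite gt_max !oppr_lt0 !ltr0n N0.
exists (fun t => A (idx t) t) => t.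
apply: (near_eq_is_derive (f := A (idx t).+1)).
- near=> z; apply: A_agree => //.
  by near: z; apply: lt_nbhsr; rewrite (lt_trans _ (idxP t)) // ltrN2 ltr_nat.
- by apply: dA; rewrite (lt_trans _ (idxP t)) // ltrN2 ltr_nat.
Unshelve. all: by end_near. Qed.

Lemma is_derive_continuous f f' : (forall t : R, is_derive t 1 f (f' t)) -> continuous f.
Proof.
by move=> df t; apply/differentiable_continuous/derivable1_diffP; have [] := df t.
Qed.

Lemma is_derive_exp_mul (mu : R) y (y' : R -> R) t : is_derive t 1 y (y' t) ->
  is_derive t 1 (fun s => expR (mu * s) * y s) (expR (mu * t) * (y' t + mu * y t)).
Proof.
move=> dy.
have dl : is_derive t 1 (fun s : R => mu * s) mu.
  by rewrite -[X in is_derive _ _ _ X]mulr1; apply: is_deriveZ_fun; exact: is_derive_id.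
have de : is_derive t 1 (fun s => expR (mu * s)) (expR (mu * t) * mu).
  exact: is_derive1_comp.
have -> : expR (mu * t) * (y' t + mu * y t) = expR (mu * t) * mu * y t + expR (mu * t) * y' t.
  ring.
exact: is_deriveM_fun.
Qed.

Lemma is_derive_reflect y y' : (forall t : R, is_derive t 1 y (y' t)) ->
  forall t : R, is_derive t 1 (fun s => y (- s)) (- y' (- t)).
Proof.
move=> dy t; by rewrite -mulrN1; apply: (is_derive1_comp (g := -%R)).
Qed.

(** The function [expR (mu * t) * y t] is nondecreasing.  If it were negative at
    [t], then [y] would be at most [expR (mu * r) * y t] at [t - r], unbounded as
    [r] grows. *)
Lemma relaxation_ge0 (mu M : R) y y' : 0 < mu ->
  (forall t : R, is_derive t 1 y (y' t)) -> (forall t, `|y t| <= M) ->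
  (forall t, 0 <= y' t + mu * y t) -> forall t, 0 <= y t.
Proof.
move=> mu0 dy yM hy t; rewrite leNgt; apply/negP => yt0.
have M0 : 0 <= M by exact: le_trans (yM 0).
(* With [1 + mu * r <= expR (mu * r)] this [r] gives [y (t - r) <= y t - M < - M]. *)
pose r := M / (mu * - y t).
have r0 : 0 <= r by rewrite divr_ge0 // mulr_ge0 ?(ltW mu0) // oppr_ge0 ltW.
have : expR (mu * (t - r)) * y (t - r) <= expR (mu * t) * y t.
  apply: (derive_ge0_nondecreasing (fun s => is_derive_exp_mul mu (dy s))).
    by move=> s; rewrite mulr_ge0 ?expR_ge0.
  by rewrite gerBl.
have -> : mu * t = mu * (t - r) + mu * r by ring.
rewrite expRD -mulrA ler_pM2l ?expR_gt0 // => h1.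
have h2 := expR_ge1Dx (mu * r).
have h3 : mu * r = M / - y t by rewrite /r; field; lra.
have h4 : expR (mu * r) * y t <= (1 + mu * r) * y t by rewrite ler_wnM2r // ltW.
have h5 : M / - y t * y t = - M by field; lra.
move: h4; rewrite mulrDl mul1r h3 h5 => h4.
have := yM (t - r); rewrite ler_norml => /andP[h6 _].
move: h1; rewrite h3 => h1; lra.
Qed.

(** Variation of constants from minus infinity without an improper integral: if [E]
    is an antiderivative of [expR (mu * t) * g t], then [E + C * expR (mu * t)] is
    nondecreasing and [E - C * expR (mu * t)] nonincreasing, for [C = M / mu].  The
    infimum [l] of the former plays the role of the value of [E] at minus infinity,
    and [expR (- mu * t) * (E t - l)] is the bounded solution. *)
Lemma relaxation_solve (mu M : R) g : 0 < mu -> continuous g -> (forall t, `|g t| <= M) ->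
  exists y, (forall t : R, is_derive t 1 y (g t - mu * y t)) /\ forall t, `|y t| <= M / mu.
Proof.
move=> mu0 cg gM; pose e t := expR (mu * t).
have de (t : R) : is_derive t 1 e (mu * e t).
  have := @is_derive_exp_mul mu (fun=> 1) (fun=> 0) t (is_derive_cst _ _ _).
  rewrite /e add0r mulr1 mulrC.
  have -> // : (fun s => expR (mu * s) * 1) = (fun s => expR (mu * s)).
  by apply/funext => s; rewrite mulr1.
have ce : continuous e by exact: is_derive_continuous de.
have [E dE] : exists E : R -> R, forall t : R, is_derive t 1 E (e t * g t).
  by apply: (@antiderivative (e \* g)) => t; apply: cvgM; [exact: ce | exact: cg].
have e0 t : 0 < e t by exact: expR_gt0.
pose C := M / mu.
have dCe t : is_derive t 1 (fun s => C * e s) (M * e t).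
  have -> : M * e t = C * (mu * e t) by rewrite mulrA divfK // gt_eqF.
  exact: is_deriveZ_fun.
pose Hp t := E t + C * e t; pose Hm t := E t - C * e t.
have Hp_homo : {homo Hp : s t / s <= t}.
  apply: (@derive_ge0_nondecreasing _ (fun t => e t * g t + M * e t)) => t.
  rewrite mulrC -mulrDl mulr_ge0 ?(ltW (e0 t)) //.
  by have := gM t; rewrite ler_norml => /andP[]; lra.
have Hm_homo : {homo (fun t => - Hm t) : s t / s <= t}.
  apply: (@derive_ge0_nondecreasing _ (fun t => - (e t * g t - M * e t))) => t.
  rewrite mulrC -mulrBl -mulNr mulr_ge0 ?(ltW (e0 t)) //.
  by have := gM t; rewrite ler_norml => /andP[]; lra.
have Hmp s t : Hm s <= Hp t.
  have M0 : 0 <= M by exact: le_trans (gM 0).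
  have C0 : 0 <= C by rewrite divr_ge0 // ltW.
  pose r := Num.min s t.
  have rs : r <= s by rewrite ge_min lexx.
  have rt : r <= t by rewrite ge_min lexx orbT.
  have := Hm_homo _ _ rs; have := Hp_homo _ _ rt.
  have := mulr_ge0 C0 (ltW (e0 r)); rewrite /Hm /Hp; lra.
pose l := inf (range Hp).
have lb : has_lbound (range Hp) by exists (Hm 0) => _ [t _ <-].
have l_le t : l <= Hp t by apply: ge_inf => //; exists t.
have l_ge t : Hm t <= l.
  apply: lb_le_inf; first by exists (Hp 0); exists 0.
  by move=> _ [s _ <-].
have eN t : expR (- mu * t) * e t = 1 by rewrite /e -expRD mulNr addNr expR0.
exists (fun t => expR (- mu * t) * (E t - l)); split=> t.
  have dEl : is_derive t 1 (fun s => E s - l) (e t * g t).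
    by rewrite -[e t * g t]subr0; apply: is_deriveB_fun; exact: is_derive_cst.
  have -> : g t - mu * (expR (- mu * t) * (E t - l)) =
      expR (- mu * t) * (e t * g t + - mu * (E t - l)).
    by rewrite [RHS]mulrDr [X in _ = X + _]mulrA eN mul1r; ring.
  exact: (is_derive_exp_mul (- mu) (y' := fun s => e s * g s)).
rewrite normrM ger0_norm ?expR_ge0 // -[leRHS]mulr1 -(eN t) mulrCA ler_pM2l ?expR_gt0 //.
rewrite ler_norml; have := l_le t; have := l_ge t; rewrite /Hm /Hp /C => ? ?.
by apply/andP; split; lra.
Qed.

(** The operator [y' - D y'' + beta y] factors as [- D (d/dt + mu) (d/dt - nu) y]:
    fixing the decay rate [mu] and letting [beta] be a function of it makes the
    roots of the characteristic polynomial rational in [D] and [mu]. *)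
Section SecondOrder.
Variables (D mu : R).
Hypotheses (D0 : 0 < D) (mu0 : 0 < mu).
Let Dn0 : D != 0. Proof. by rewrite gt_eqF. Qed.
Let mun0 : mu != 0. Proof. by rewrite gt_eqF. Qed.
Let nu := D^-1 + mu.
Let beta := mu + D * mu ^+ 2.

(** The two first-order factors are solved one after the other; the factor
    [d/dt - nu] becomes a relaxation equation after reversing time. *)
Lemma elliptic_solve (M : R) g : continuous g -> (forall t, `|g t| <= M) ->
  exists y y1 y2, [/\ forall t : R, is_derive t 1 y (y1 t),
    forall t : R, is_derive t 1 y1 (y2 t),
    forall t, y1 t - D * y2 t + beta * y t = g t,
    forall t, `|y t| <= M / beta & forall t, `|y1 t| <= 2 * M / (D * mu)].
Proof.
move=> cg gM.
have nu0 : 0 < nu by rewrite addr_gt0 ?invr_gt0.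
have betaE : beta = D * mu * nu by rewrite /beta /nu; field; rewrite ?Dn0 ?mun0.
have [w [dw wM]] : exists w, (forall t : R, is_derive t 1 w (- (g t / D) - mu * w t)) /\
    forall t, `|w t| <= M / D / mu.
  apply: relaxation_solve => // t; last first.
    by rewrite normrN normrM [X in _ * X]gtr0_norm ?invr_gt0 // ler_pM2r ?invr_gt0.
  by apply: cvgN; apply: cvgM; [exact: cg | exact: cvg_cst].
have [z [dz zM]] : exists z, (forall t : R, is_derive t 1 z (- w (- t) - nu * z t)) /\
    forall t, `|z t| <= M / D / mu / nu.
  apply: relaxation_solve => // t; last by rewrite normrN.
  apply: cvgN; apply: (@continuous_comp _ _ _ -%R w); first exact: opp_continuous.
  exact: is_derive_continuous dw _.
pose y t := z (- t); pose y1 t := nu * y t + w t.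
have dy (t : R) : is_derive t 1 y (y1 t).
  have -> : y1 t = - (- w (- - t) - nu * z (- t)) by rewrite /y1 /y opprK; ring.
  exact: (is_derive_reflect dz).
pose y2 t := nu * y1 t + (- (g t / D) - mu * w t).
exists y, y1, y2; split => // t.
- by apply: is_deriveD_fun => //; exact: is_deriveZ_fun.
- by rewrite /y2 /y1 /beta /nu; field; rewrite ?Dn0 ?mun0.
- by rewrite betaE; apply: le_trans (zM _) _; rewrite !invfM !mulrA.
- apply: le_trans (ler_normD _ _) _; rewrite normrM gtr0_norm //.
  have -> : 2 * M / (D * mu) = nu * (M / D / mu / nu) + M / D / mu.
    by field; rewrite Dn0 mun0 gt_eqF.
  by rewrite lerD ?ler_pM2l //; exact: zM.
Qed.

(** The function [nu * y - y'] satisfies the hypotheses of the first-order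
    comparison; then so does [y] with time reversed. *)
Lemma elliptic_ge0 (M M1 : R) y y1 y2 :
  (forall t : R, is_derive t 1 y (y1 t)) -> (forall t : R, is_derive t 1 y1 (y2 t)) ->
  (forall t, `|y t| <= M) -> (forall t, `|y1 t| <= M1) ->
  (forall t, 0 <= y1 t - D * y2 t + beta * y t) -> forall t, 0 <= y t.
Proof.
move=> dy dy1 yM y1M Ly.
have nu0 : 0 < nu by rewrite addr_gt0 ?invr_gt0.
pose w t := nu * y t - y1 t.
have dw (t : R) : is_derive t 1 w (nu * y1 t - y2 t).
  by apply: is_deriveB_fun => //; exact: is_deriveZ_fun.
have w0 : forall t, 0 <= w t.
  apply: (relaxation_ge0 (M := nu * M + M1) mu0 dw) => t.
    apply: le_trans (ler_normB _ _) _; rewrite normrM gtr0_norm //.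
    by rewrite lerD // ler_pM2l.
  have -> : nu * y1 t - y2 t + mu * w t = D^-1 * (y1 t - D * y2 t + beta * y t).
    by rewrite /w /beta /nu; field; rewrite ?Dn0 ?mun0.
  by rewrite mulr_ge0 // invr_ge0 ltW.
move=> t; rewrite -(opprK t).
apply: (relaxation_ge0 (M := M) nu0 (is_derive_reflect dy)) => // s.
by have := w0 (- s); rewrite /w addrC.
Qed.

End SecondOrder.

End Analysis.

(** * Limits along an ultrafilter *)

Section Limits.
Variable R : realType.
Implicit Types (s t : R).

Lemma cvg_le_bound (T : Type) (F : set_system T) (FF : ProperFilter F) (u : T -> R) (l C : R) :
  u x @[x --> F] --> l -> (forall x, u x <= C) -> l <= C.
Proof.
move=> ul uC; apply: (@closed_cvg _ _ _ FF u [set y | y <= C]) ul.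
  exact: closed_le.
exact: nearW.
Qed.

Lemma ultra_bounded_cvg (T : Type) (F : set_system T) (FF : UltraFilter F)
    (u : T -> R) (M : R) :
  (forall x, `|u x| <= M) -> exists l : R, u x @[x --> F] --> l.
Proof.
move=> uM.
have [|l [_ lcl]] := @segment_compact R (- M) M (u @ F) (fmap_proper_filter _ _).
  by apply: nearW => x /=; rewrite in_itv /= -ler_norml.
exists l => V lV /=.
have [//|UnV] := in_ultra_setVsetC (u @^-1` V) FF.
by have [y []] := lcl (~` V) V UnV lV.
Qed.

Lemma taylor_lipschitz (f f1 : R -> R) (L : R) : 0 <= L ->
  (forall t, is_derive t 1 f (f1 t)) -> (forall s t, `|f1 s - f1 t| <= L * `|s - t|) ->
  forall s t, `|f s - f t - (s - t) * f1 t| <= L * (s - t) ^+ 2.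
Proof.
move=> L0 df f1L s t.
have mv a b : a < b -> exists2 c, a < c < b & f b - f a = f1 c * (b - a).
  move=> ab; have [|c] := MVT ab (fun x _ => df x).
    exact/continuous_subspaceT/(is_derive_continuous df).
  by rewrite in_itv /= => cab ?; exists c.
have bound c : `|c - t| <= `|s - t| -> f s - f t = f1 c * (s - t) ->
    `|f s - f t - (s - t) * f1 t| <= L * (s - t) ^+ 2.
  move=> ct ->; rewrite mulrC -mulrBr normrM -[_ ^+ 2]real_normK ?num_real //.
  by rewrite expr2 mulrCA ler_wpM2l // (le_trans (f1L _ _)) // ler_wpM2l.
have [st|st|->] := ltgtP s t.
- have [c /andP[sc ct] e] := mv _ _ st.
  apply: (bound c); last by rewrite -opprB e -mulrN opprB.
  by rewrite !ltr0_norm ?subr_lt0 // lerN2 lerB // ltW.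
- have [c /andP[tc cs] e] := mv _ _ st.
  by apply: (bound c) => //; rewrite !gtr0_norm ?subr_gt0 // lerB // ltW.
- by rewrite !subrr mul0r subrr normr0 expr0n mulr0.
Qed.

(** Pointwise convergence suffices here: the first-order Taylor remainder of [u m]
    at [t] is at most [L * (s - t) ^+ 2], uniformly in [m], and this bound survives
    in the limit. *)
Lemma lipschitz_derive_limit (T : Type) (F : set_system T) (FF : ProperFilter F)
    (u v : T -> R -> R) (a b : R -> R) (L : R) : 0 <= L ->
  (forall m t, is_derive t 1 (u m) (v m t)) ->
  (forall m s t, `|v m s - v m t| <= L * `|s - t|) ->
  (forall t, u m t @[m --> F] --> a t) -> (forall t, v m t @[m --> F] --> b t) ->
  forall t, is_derive t 1 a (b t).
Proof.
move=> L0 du vL ua vb t.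
have ab s : `|a s - a t - (s - t) * b t| <= L * (s - t) ^+ 2.
  apply: (@cvg_le_bound T F FF (fun m => `|u m s - u m t - (s - t) * v m t|)).
    apply: cvg_norm; apply: cvgB; first exact: cvgB.
    by apply: cvgM; [exact: cvg_cst | exact: vb].
  by move=> m; exact: taylor_lipschitz.
have lim : h^-1 *: (a (h *: (1 : R) + t) - a t) @[h --> 0^'] --> b t.
  apply/cvgrPdist_le => e e0; near=> h.
  have h0 : h != 0 by near: h; exact: nbhs_dnbhs_neq.
  have hn0 : 0 < `|h| by rewrite normr_gt0.
  rewrite /GRing.scale /= mulr1 -(ler_pM2l hn0) -normrM.
  have -> : h * (b t - h^-1 * (a (h + t) - a t)) = - (a (h + t) - a t - (h + t - t) * b t).
    by field.
  rewrite normrN (le_trans (ab _)) // addrK.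
  rewrite -real_normK ?num_real // expr2 mulrCA ler_pM2l //.
  have hle : `|h| <= e / (L + 1).
    near: h; apply: dnbhs0_le; rewrite divr_gt0 //; lra.
  have L1 : 0 < L + 1 by lra.
  move: hle; rewrite ler_pdivlMr // mulrC; apply: le_trans.
  by rewrite ler_pM2r // lerDl.
by apply: DeriveDef; [apply/cvg_ex; exists (b t) | apply: cvg_lim].
Unshelve. all: by end_near. Qed.

End Limits.

(** * Lipschitz interpolation *)

Section Interp.
Variable R : realType.
Implicit Types (s t : R).

Lemma max_dist_le (a b c d e : R) : `|a - c| <= e -> `|b - d| <= e ->
  `|Num.max a b - Num.max c d| <= e.
Proof.
rewrite !ler_norml => /andP[? ?] /andP[? ?].
by case: (leP a b) => ?; case: (leP c d) => ?; apply/andP; split; lra.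
Qed.

Lemma min_dist_le (a b c d e : R) : `|a - c| <= e -> `|b - d| <= e ->
  `|Num.min a b - Num.min c d| <= e.
Proof.
rewrite !ler_norml => /andP[? ?] /andP[? ?].
by case: (leP a b) => ?; case: (leP c d) => ?; apply/andP; split; lra.
Qed.

Lemma dist3_le (a a' b b' c c' x y z : R) : `|a - a'| <= x -> `|b - b'| <= y ->
  `|c - c'| <= z -> `|(a + b - c) - (a' + b' - c')| <= x + y + z.
Proof.
rewrite !ler_norml => /andP[? ?] /andP[? ?] /andP[? ?].
by apply/andP; split; lra.
Qed.

Lemma bigmin_dist_le (I : finType) (B e : R) (a b : I -> R) : 0 <= e ->
  (forall q, `|a q - b q| <= e) ->
  `|\big[Num.min/B]_q a q - \big[Num.min/B]_q b q| <= e.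
Proof.
move=> e0 ab; apply: (big_ind2 (fun x y => `|x - y| <= e)) => //.
- by rewrite subrr normr0.
- by move=> *; exact: min_dist_le.
Qed.

Lemma derive_bounded_lipschitz (f f1 : R -> R) (M : R) :
  (forall t, is_derive t 1 f (f1 t)) -> (forall t, `|f1 t| <= M) ->
  forall s t, `|f s - f t| <= M * `|s - t|.
Proof.
move=> df f1M.
have le s t : s <= t -> `|f s - f t| <= M * `|s - t|.
  move=> st; have dM (z : R) : is_derive z 1 (fun x => M * x) M.
    by rewrite -[X in is_derive _ _ _ X]mulr1; apply: is_deriveZ_fun; exact: is_derive_id.
  have hp : {homo (fun z => M * z - f z) : s t / s <= t}.
    apply: (@derive_ge0_nondecreasing _ _ (fun z => M - f1 z)) => z.
    by have := f1M z; rewrite ler_norml => /andP[]; lra.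
  have hm : {homo (fun z => M * z + f z) : s t / s <= t}.
    apply: (@derive_ge0_nondecreasing _ _ (fun z => M + f1 z)) => z.
    by have := f1M z; rewrite ler_norml => /andP[]; lra.
  have := hp _ _ st; have := hm _ _ st; rewrite /= => ? ?.
  rewrite (ler0_norm (x := s - t)) ?subr_le0 // ler_norml.
  by apply/andP; split; lra.
move=> s t; case: (leP s t) => [/le//|/ltW/le].
by rewrite distrC (distrC t).
Qed.

Lemma lipschitz_continuous (f : R -> R) (L : R) :
  (forall s t, `|f s - f t| <= L * `|s - t|) -> continuous f.
Proof.
move=> fL t.
have L0 : 0 <= L.
  by have := le_trans (normr_ge0 _) (fL 1 0); rewrite subr0 normr1 mulr1.
have L1 : 0 < L + 1 by lra.
apply/cvgrPdist_le => e e0; near=> s.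
apply: le_trans (fL _ _) _.
have hle : `|t - s| <= e / (L + 1).
  near: s; apply: cvgr_dist_le; [exact: cvg_id | exact: divr_gt0].
move: hle; rewrite ler_pdivlMr // mulrC; apply: le_trans; rewrite ler_wpM2r // lerDl.
Unshelve. all: by end_near. Qed.

Variables (I : finType) (p : I -> R) (B L : R).
Hypothesis L0 : 0 <= L.

(** The McShane extension of the data [x] at the nodes [p], capped at [B].  Unlike
    piecewise linear interpolation, it has the Lipschitz constant [L] whatever the
    data, and it is 1-Lipschitz in the data. *)
Definition mcshane (x : I -> R) (t : R) := \big[Num.min/B]_q (x q + L * `|t - p q|).

Lemma mcshane_lipschitz x s t : `|mcshane x s - mcshane x t| <= L * `|s - t|.
Proof.
apply: bigmin_dist_le => [|q]; first by rewrite mulr_ge0.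
rewrite opprD addrACA subrr add0r -mulrBr normrM ger0_norm // ler_wpM2l //.
apply: le_trans (ler_dist_dist _ _) _.
by rewrite opprB addrA subrK.
Qed.

Lemma mcshane_dist_le x x' t (e : R) : 0 <= e -> (forall q, `|x q - x' q| <= e) ->
  `|mcshane x t - mcshane x' t| <= e.
Proof. by move=> e0 xx; apply: bigmin_dist_le => // q; rewrite opprD addrACA subrr addr0. Qed.

(** The extension of exact data of an [L]-Lipschitz function bounded by [B] lies
    above that function, and the term of the node [q] bounds it from above. *)
Lemma mcshane_approx x (y : R -> R) (e : R) : 0 <= e ->
  (forall s t, `|y s - y t| <= L * `|s - t|) -> (forall t, y t <= B) ->
  (forall q, `|y (p q) - x q| <= e) ->
  forall t q, `|mcshane x t - y t| <= e + 2 * L * `|t - p q|.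
Proof.
move=> e0 yL yB yx t q; have Lq0 : 0 <= L * `|t - p q| by rewrite mulr_ge0.
have lower : y t - e <= mcshane x t.
  apply: le_bigmin => [|r _]; first by have := yB t; lra.
  have := yL t (p r); have := yx r; rewrite !ler_norml => /andP[? ?] /andP[? ?]; lra.
have upper : mcshane x t <= x q + L * `|t - p q| by apply: bigmin_le_cond.
have := yL t (p q); have := yx q; rewrite !ler_norml => /andP[? ?] /andP[? ?].
by apply/andP; split; lra.
Qed.

End Interp.

(** The nodes have mesh [1 / m.+1] and cover the interval from [- m.+1] to [m.+1],
    so that one index [m] refines the mesh and enlarges the window together. *)
Section Grid.
Variable R : realType.
Definition grid (m : nat) (q : 'I_(2 * m.+1 ^ 2).+1) : R := q%:R / m.+1%:R - m.+1%:R.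

Lemma grid_dense m (t : R) : `|t| <= m.+1%:R -> exists q, `|t - @grid m q| <= m.+1%:R^-1.
Proof.
rewrite ler_norml => /andP[tl tu].
have m0 : 0 < m.+1%:R :> R by rewrite ltr0n.
pose z := (t + m.+1%:R) * m.+1%:R.
have z0 : 0 <= z by rewrite mulr_ge0 ?ler0n // -lerBlDr sub0r.
have /andP[qz zq] := truncn_itv z0.
have zN : z <= (2 * m.+1 ^ 2)%:R.
  rewrite natrM expnS expn1 natrM mulrA ler_pM2r //; lra.
have qN : (Num.truncn z < (2 * m.+1 ^ 2).+1)%N.
  by rewrite ltnS -(ler_nat R) (le_trans qz).
exists (Ordinal qN); rewrite /grid /=.
have -> : t - ((Num.truncn z)%:R / m.+1%:R - m.+1%:R) = (z - (Num.truncn z)%:R) / m.+1%:R.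
  by rewrite /z; field; rewrite gt_eqF.
rewrite normrM [X in _ * X]gtr0_norm ?invr_gt0 // ger_pMl ?invr_gt0 //.
by rewrite ger0_norm ?subr_ge0 // lerBlDl -natr1 in zq *; exact: ltW.
Qed.
End Grid.

(** * Existence of a profile between the lower and the upper solution *)

(** Mixed quasimonotonicity enters only through [F_up] and [F_lo]: replacing the
    own component of a function in the strip by [up i] gives a reaction term for
    which [up i] is still an upper solution, and likewise for [lo i]. *)
Section Existence.
Variables (R : realType) (J : finType).
Implicit Types (s t : R) (i j : J) (psi : J -> R -> R).
Variables (D tau : J -> R) (F : J -> (J -> R) -> (J -> R) -> R) (k B M1 : R).
Variables (up up1 up2 lo lo1 lo2 : J -> R -> R).
Hypothesis D0 : forall i, 0 < D i.
Hypothesis k0 : 0 <= k.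
Hypothesis B0 : 0 < B.
Hypothesis F_lip : forall i (u u' v v' : J -> R) (e : R),
  (forall j, `|u j - u' j| <= e) -> (forall j, `|v j - v' j| <= e) ->
  `|F i u v - F i u' v'| <= k * e.
Hypothesis dup : forall i t, is_derive t 1 (up i) (up1 i t).
Hypothesis dup1 : forall i t, is_derive t 1 (up1 i) (up2 i t).
Hypothesis dlo : forall i t, is_derive t 1 (lo i) (lo1 i t).
Hypothesis dlo1 : forall i t, is_derive t 1 (lo1 i) (lo2 i t).
Hypothesis up1M : forall i t, `|up1 i t| <= M1.
Hypothesis lo1M : forall i t, `|lo1 i t| <= M1.
Hypothesis lo0 : forall i t, 0 <= lo i t.
Hypothesis lo_up : forall i t, lo i t <= up i t.
Hypothesis upB : forall i t, up i t <= B.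

Definition between psi := forall i t, lo i t <= psi i t <= up i t.

Definition replace_at i (a : R) (u : J -> R) : J -> R := fun j => if j == i then a else u j.

Hypothesis F_up : forall psi, between psi -> forall i t,
  F i (replace_at i (up i t) (psi^~ t)) (fun j => psi j (t - tau j)) <=
    up1 i t - D i * up2 i t.
Hypothesis F_lo : forall psi, between psi -> forall i t,
  lo1 i t - D i * lo2 i t <=
    F i (replace_at i (lo i t) (psi^~ t)) (fun j => psi j (t - tau j)).

(** With this [mu], [beta i] exceeds the Lipschitz constant [k], so that adding
    [beta i * psi i] makes the reaction term nondecreasing in its own component. *)
Let mu := k + 1.
Let beta i := mu + D i * mu ^+ 2.

Let mu0 : 0 < mu. Proof. by rewrite ltr_wpDl. Qed.
Let beta_gt0 i : 0 < beta i.
Proof. by rewrite addr_gt0 // mulr_gt0 // exprn_gt0. Qed.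
Let k_beta i : k <= beta i.
Proof.
have : 0 <= D i * mu ^+ 2 by rewrite mulr_ge0 ?ltW // exprn_gt0.
rewrite /beta /mu; lra.
Qed.

Definition clip psi j t := Num.max (lo j t) (Num.min (up j t) (psi j t)).

Lemma clip_between psi : between (clip psi).
Proof. by move=> j t; rewrite /clip le_max lexx /= ge_max lo_up ge_min lexx. Qed.

Lemma clip_id psi : between psi -> clip psi = psi.
Proof.
move=> hpsi; apply/funext => j; apply/funext => t; have /andP[? ?] := hpsi j t.
by rewrite /clip min_r // max_r.
Qed.

Definition source psi i t :=
  F i (clip psi ^~ t) (fun j => clip psi j (t - tau j)) + beta i * clip psi i t.

Lemma source_dist_le psi psi' i s t (e : R) :
  (forall j, `|clip psi j s - clip psi' j t| <= e) ->
  (forall j, `|clip psi j (s - tau j) - clip psi' j (t - tau j)| <= e) ->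
  `|source psi i s - source psi' i t| <= (k + beta i) * e.
Proof.
move=> h1 h2; rewrite /source opprD addrACA -mulrBr [leRHS]mulrDl.
apply: le_trans (ler_normD _ _) _. apply: lerD; first exact: F_lip.
by rewrite normrM gtr0_norm // ler_pM2l.
Qed.

Lemma clip_dist_le psi psi' j t (e : R) : `|psi j t - psi' j t| <= e ->
  `|clip psi j t - clip psi' j t| <= e.
Proof.
move=> h; have e0 := le_trans (normr_ge0 _) h.
by apply: max_dist_le; [|apply: min_dist_le]; rewrite ?subrr ?normr0.
Qed.

Section Regular.
Variables (L : R) (psi : J -> R -> R).
Hypothesis M1L : M1 <= L.
Hypothesis psiL : forall j s t, `|psi j s - psi j t| <= L * `|s - t|.

Lemma clip_lipschitz j s t : `|clip psi j s - clip psi j t| <= L * `|s - t|.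
Proof.
have weak (f f1 : R -> R) : (forall t, is_derive t 1 f (f1 t)) ->
    (forall t, `|f1 t| <= M1) -> `|f s - f t| <= L * `|s - t|.
  move=> df fM; apply: le_trans (derive_bounded_lipschitz df fM s t) _.
  by rewrite ler_wpM2r.
apply: max_dist_le; first exact: weak (@lo1M j).
by apply: min_dist_le => //; exact: weak (@up1M j).
Qed.

Lemma source_lipschitz i s t : `|source psi i s - source psi i t| <= (k + beta i) * L * `|s - t|.
Proof.
rewrite -mulrA; apply: source_dist_le => j; first exact: clip_lipschitz.
apply: le_trans (clip_lipschitz _ _ _) _.
by rewrite opprB addrA subrK.
Qed.
End Regular.

Let M : R := \sum_i (`|F i (fun=> 0) (fun=> 0)| + (k + beta i) * B).

Lemma source_bounded psi i t : `|source psi i t| <= M.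
Proof.
have Mi : `|F i (fun=> 0) (fun=> 0)| + (k + beta i) * B <= M.
  rewrite /M (bigD1 i) //= lerDl sumr_ge0 // => j _.
  by rewrite addr_ge0 // mulr_ge0 ?(ltW B0) // addr_ge0 // ltW.
apply: le_trans Mi.
have cB j s : `|clip psi j s - 0| <= B.
  have /andP[h1 h2] := clip_between psi j s.
  by rewrite subr0 ger0_norm ?(le_trans h2) // (le_trans _ h1).
rewrite /source (mulrDl k) addrA; apply: le_trans (ler_normD _ _) _; apply: lerD.
  rewrite -[F i _ _](subrK (F i (fun=> 0) (fun=> 0))) addrC.
  apply: le_trans (ler_normD _ _) _; rewrite lerD //.
  by apply: F_lip => j; exact: cB.
by rewrite normrM gtr0_norm // ler_pM2l // -(subr0 (clip _ _ _)).
Qed.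

(** Moving the own component from [clip psi i t] to [up i t] changes the reaction
    term by at most [k] times the distance, which the increase of
    [beta i * clip psi i t] compensates as [k <= beta i]. *)
Lemma source_between psi i t :
  lo1 i t - D i * lo2 i t + beta i * lo i t <= source psi i t <=
  up1 i t - D i * up2 i t + beta i * up i t.
Proof.
have bc := clip_between psi; have /andP[clo cup] := bc i t.
have dist (a : R) : `|F i (clip psi ^~ t) (fun j => clip psi j (t - tau j)) -
   F i (replace_at i a (clip psi ^~ t)) (fun j => clip psi j (t - tau j))| <=
   k * `|clip psi i t - a|.
  apply: F_lip => j; last by rewrite subrr normr0.
  by rewrite /replace_at; case: eqP => [->|_]; rewrite ?subrr ?normr0.
have := F_up bc i t; have := F_lo bc i t.
have := dist (lo i t); have := dist (up i t).
rewrite (ger0_norm (x := clip psi i t - lo i t)) ?subr_ge0 //.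
rewrite (ler0_norm (x := clip psi i t - up i t)) ?subr_le0 //.
have h1 : k * - (clip psi i t - up i t) <= beta i * - (clip psi i t - up i t).
  by rewrite ler_wpM2r // oppr_ge0 subr_le0.
have h2 : k * (clip psi i t - lo i t) <= beta i * (clip psi i t - lo i t).
  by rewrite ler_wpM2r // subr_ge0.
rewrite /source !ler_norml => /andP[? ?] /andP[? ?] ? ?; apply/andP; split; lra.
Qed.

Definition solves psi i (y y1 y2 : R -> R) :=
  [/\ forall t, is_derive t 1 y (y1 t), forall t, is_derive t 1 y1 (y2 t),
      forall t, y1 t - D i * y2 t + beta i * y t = source psi i t,
      forall t, `|y t| <= M / beta i & forall t, `|y1 t| <= 2 * M / (D i * mu)].

Lemma solves_between psi i y y1 y2 : solves psi i y y1 y2 ->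
  forall t, lo i t <= y t <= up i t.
Proof.
case=> dy dy1 eq yM y1M t; apply/andP; split; rewrite -subr_ge0.
  apply: (@elliptic_ge0 R (D i) mu (D0 i) mu0 (M / beta i + B) (2 * M / (D i * mu) + M1)
    (fun t => y t - lo i t) (fun t => y1 t - lo1 i t) (fun t => y2 t - lo2 i t)) => s.
  - rewrite (le_trans (ler_normB _ _)) // lerD //.
    by rewrite ger0_norm // (le_trans (lo_up _ _)).
  - by rewrite (le_trans (ler_normB _ _)) // lerD.
  - have /andP[h _] := source_between psi i s; have := eq s; rewrite -/(beta i); lra.
apply: (@elliptic_ge0 R (D i) mu (D0 i) mu0 (B + M / beta i) (M1 + 2 * M / (D i * mu))
  (fun t => up i t - y t) (fun t => up1 i t - y1 t) (fun t => up2 i t - y2 t)) => s.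
- rewrite (le_trans (ler_normB _ _)) // lerD // ger0_norm //.
  exact: le_trans (lo0 _ _) (lo_up _ _).
- by rewrite (le_trans (ler_normB _ _)) // lerD.
- have /andP[_ h] := source_between psi i s; have := eq s; rewrite -/(beta i); lra.
Qed.

(** The constant [e / beta i] solves the equation with right side [e]; comparing it
    with the difference of the two solutions gives the bound. *)
Lemma solves_dist_le psi psi' i y y1 y2 z z1 z2 (e : R) :
  solves psi i y y1 y2 -> solves psi' i z z1 z2 ->
  (forall t, `|source psi i t - source psi' i t| <= e) -> forall t, `|y t - z t| <= e / beta i.
Proof.
suff le psi1 psi2 (a a1 a2 b b1 b2 : R -> R) :
  solves psi1 i a a1 a2 -> solves psi2 i b b1 b2 ->
  (forall t, `|source psi1 i t - source psi2 i t| <= e) -> forall t, a t - b t <= e / beta i.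
  move=> hy hz he t; rewrite ler_norml (le _ _ _ _ _ _ _ _ hy hz) // andbT lerNl opprB.
  by apply: (le _ _ _ _ _ _ _ _ hz hy) => s; rewrite distrC.
move=> [da da1 eqa aM a1M] [db db1 eqb bM b1M] he t; rewrite -subr_ge0.
apply: (@elliptic_ge0 R (D i) mu (D0 i) mu0 (`|e / beta i| + (M / beta i + M / beta i))
  (2 * M / (D i * mu) + 2 * M / (D i * mu))
  (fun t => e / beta i - (a t - b t)) (fun t => 0 - (a1 t - b1 t))
  (fun t => 0 - (a2 t - b2 t))) => s.
- rewrite (le_trans (ler_normB _ _)) // lerD // (le_trans (ler_normB _ _)) // lerD //.
- by rewrite sub0r normrN (le_trans (ler_normB _ _)) // lerD.
- have := he s; rewrite -eqa -eqb ler_norml => /andP[_].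
  have : beta i * (e / beta i) = e by rewrite mulrC divfK // gt_eqF.
  rewrite -/(beta i) !mulrBr => ->; lra.
Qed.

Lemma solve_exists psi (L : R) : M1 <= L ->
  (forall j s t, `|psi j s - psi j t| <= L * `|s - t|) ->
  exists y y1 y2 : J -> R -> R, forall i, solves psi i (y i) (y1 i) (y2 i).
Proof.
move=> M1L psiL.
have sol i : exists y : (R -> R) * (R -> R) * (R -> R), solves psi i y.1.1 y.1.2 y.2.
  have [||y [y1 [y2 h]]] := @elliptic_solve R (D i) mu (D0 i) mu0 M (source psi i).
  - exact: lipschitz_continuous (@source_lipschitz L psi M1L psiL i).
  - exact: source_bounded.
  by exists (y, y1, y2).
have [S hS] := choice sol.
by exists (fun i => (S i).1.1), (fun i => (S i).1.2), (fun i => (S i).2).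
Qed.

(** A common Lipschitz constant for [up], [lo] and all solutions. *)
Let L : R := `|M1| + \sum_i `|2 * M / (D i * mu)|.

Let L0 : 0 <= L. Proof. by rewrite addr_ge0 // sumr_ge0. Qed.
Let M1L : M1 <= L.
Proof. by rewrite (le_trans (ler_norm _)) // lerDl sumr_ge0. Qed.
Let velocity_le i : 2 * M / (D i * mu) <= L.
Proof.
rewrite (le_trans (ler_norm _)) // /L (bigD1 i) //= addrCA lerDl.
by rewrite addr_ge0 // sumr_ge0.
Qed.

(** The finite-dimensional reduction: a vector of samples is interpolated, the
    equation is solved with the resulting source, and the solution is sampled
    again.  As [(k + beta i) / beta i <= 2], this map is 2-Lipschitz.  At an
    approximate fixed point the interpolation and the solution agree up to the mesh
    size, both being [L]-Lipschitz. *)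
Lemma approx_solution (m : nat) : exists psi y y1 y2 : J -> R -> R,
  [/\ forall j s t, `|psi j s - psi j t| <= L * `|s - t|,
      forall i, solves psi i (y i) (y1 i) (y2 i)
    & forall j t, `|t| <= m.+1%:R -> `|psi j t - y j t| <= (1 + 2 * L) / m.+1%:R].
Proof.
pose X := (J * 'I_(2 * m.+1 ^ 2).+1)%type.
pose ps (x : X -> R) j := mcshane (@grid R m) B L (fun q => x (j, q)).
have psL x j s t : `|ps x j s - ps x j t| <= L * `|s - t| by exact: mcshane_lipschitz.
have sol x : exists y : (J -> R -> R) * (J -> R -> R) * (J -> R -> R),
    forall i, solves (ps x) i (y.1.1 i) (y.1.2 i) (y.2 i).
  have [y [y1 [y2 h]]] := solve_exists M1L (psL x).
  by exists (y, y1, y2).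
have [S hS] := choice sol.
pose G (x : X -> R) (p : X) := (S x).1.1 p.1 (@grid R m p.2).
have e0 : 0 < m.+1%:R^-1 :> R by rewrite invr_gt0 ltr0n.
have [|x x' h _ _ xh [i q]|x [_ xfix]] :=
    @approx_fixed_point R X B 2 G B0 (ler0n _ _) _ _ _ e0.
- move=> x _ [i q]; have /andP[h1 h2] := solves_between (hS x i) (grid R q).
  by rewrite (le_trans _ h1) // (le_trans h2).
- have h0 := le_trans (normr_ge0 _) (xh (i, q)).
  apply: (@le_trans _ _ ((k + beta i) * h / beta i)); last first.
    rewrite ler_pdivrMr // mulrAC ler_wpM2r //.
    by have := k_beta i; lra.
  apply: (solves_dist_le (hS x i) (hS x' i)) => t.
  have close j u : `|clip (ps x) j u - clip (ps x') j u| <= h.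
    by apply: clip_dist_le; apply: mcshane_dist_le => // r; exact: xh.
  by apply: source_dist_le => j; exact: close.
exists (ps x), (S x).1.1, (S x).1.2, (S x).2; split => // j t tm.
have [q tq] := grid_dense tm.
have [dy dy1 _ yM y1M] := hS x j.
apply: (@le_trans _ _ (m.+1%:R^-1 + 2 * L * `|t - grid R q|)).
  apply: mcshane_approx => //.
  - move=> s u; apply: le_trans (derive_bounded_lipschitz dy y1M s u) _.
    by rewrite ler_wpM2r.
  - by move=> u; have /andP[_ /le_trans] := solves_between (hS x j) u; apply.
  - by move=> r; exact: (xfix (j, r)).
by rewrite [leRHS]mulrDl mul1r lerD2l ler_wpM2l // mulr_ge0.
Qed.

(** The equation expresses the second derivatives through the solution, its first
    derivative and the source, so they are uniformly bounded and Lipschitz; the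
    ultrafilter limits of the solutions and of their first two derivatives are then
    related by differentiation.  The interpolations have the same limit as the
    solutions, so the limit solves the equation with its own source, and it lies in
    the strip, where the truncation is the identity. *)
Lemma profile_between_exists : exists phi phi1 phi2 : J -> R -> R,
  [/\ forall i t, is_derive t 1 (phi i) (phi1 i t) /\ is_derive t 1 (phi1 i) (phi2 i t),
      forall i, continuous (phi2 i),
      exists C, forall i t, `|phi1 i t| <= C /\ `|phi2 i t| <= C,
      forall i t, phi1 i t - D i * phi2 i t = F i (phi^~ t) (fun j => phi j (t - tau j))
    & between phi].
Proof.
have appr (m : nat) : exists T : (J -> R -> R) * (J -> R -> R) * (J -> R -> R) * (J -> R -> R),
  [/\ forall j s t, `|T.1.1.1 j s - T.1.1.1 j t| <= L * `|s - t|,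
      forall i, solves T.1.1.1 i (T.1.1.2 i) (T.1.2 i) (T.2 i)
    & forall j t, `|t| <= m.+1%:R -> `|T.1.1.1 j t - T.1.1.2 j t| <= (1 + 2 * L) / m.+1%:R].
  have [psi [y [y1 [y2 h]]]] := approx_solution m.
  by exists (psi, y, y1, y2).
have [T hT] := choice appr.
pose psi m := (T m).1.1.1; pose y m := (T m).1.1.2.
pose y1 m := (T m).1.2; pose y2 m := (T m).2.
have psiL m j s t : `|psi m j s - psi m j t| <= L * `|s - t| by have [h _ _] := hT m; exact: h.
have ysol m i : solves (psi m) i (y m i) (y1 m i) (y2 m i) by have [_ h _] := hT m; exact: h.
have psiy m j t : `|t| <= m.+1%:R -> `|psi m j t - y m j t| <= (1 + 2 * L) / m.+1%:R.
  by have [_ _ h] := hT m; exact: h.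
pose C1 i := 2 * M / (D i * mu).
pose C2 i := (C1 i + M + M) / D i.
have y2E m i t : y2 m i t = (y1 m i t + beta i * y m i t - source (psi m) i t) / D i.
  have [_ _ h _ _] := ysol m i; rewrite -h /beta; field.
  by rewrite gt_eqF.
have y2M m i t : `|y2 m i t| <= C2 i.
  rewrite y2E normrM (gtr0_norm (x := (D i)^-1)) ?invr_gt0 // ler_pM2r ?invr_gt0 //.
  have [_ _ _ h h1] := ysol m i.
  rewrite (le_trans (ler_normB _ _)) // lerD ?source_bounded //.
  rewrite (le_trans (ler_normD _ _)) // lerD ?h1 //.
  by rewrite normrM gtr0_norm // mulrC -ler_pdivlMr.
pose L2 i := (C2 i + beta i * C1 i + (k + beta i) * L) / D i.
have y2L m i s t : `|y2 m i s - y2 m i t| <= L2 i * `|s - t|.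
  have [dy dy1 _ h h1] := ysol m i.
  rewrite !y2E -mulrBl normrM (gtr0_norm (x := (D i)^-1)) ?invr_gt0 //.
  rewrite /L2 mulrAC ler_pM2r ?invr_gt0 //.
  rewrite [leRHS]mulrDl (mulrDl (C2 i)); apply: dist3_le.
  - exact: derive_bounded_lipschitz dy1 (y2M m i) s t.
  - rewrite -mulrBr normrM gtr0_norm // -mulrA ler_pM2l //.
    exact: derive_bounded_lipschitz dy h1 s t.
  - exact: source_lipschitz M1L (psiL m) i s t.
have [U [ultraU subU]] := ultraFilterLemma (eventually_filter : ProperFilter \oo).
have largeU (r : R) : \forall m \near U, r <= m%:R by apply: subU; exact: nbhs_infty_ger.
pose phi i t := lim (y m i t @[m --> U]).
pose phi1 i t := lim (y1 m i t @[m --> U]).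
pose phi2 i t := lim (y2 m i t @[m --> U]).
have yphi i t : y m i t @[m --> U] --> phi i t.
  have [|l hl] := @ultra_bounded_cvg R nat U ultraU (fun m => y m i t) (M / beta i).
    by move=> m; have [_ _ _ h _] := ysol m i; exact: h.
  by rewrite /phi (cvg_lim _ hl).
have y1phi i t : y1 m i t @[m --> U] --> phi1 i t.
  have [|l hl] := @ultra_bounded_cvg R nat U ultraU (fun m => y1 m i t) (C1 i).
    by move=> m; have [_ _ _ _ h] := ysol m i; exact: h.
  by rewrite /phi1 (cvg_lim _ hl).
have y2phi i t : y2 m i t @[m --> U] --> phi2 i t.
  have [|l hl] := @ultra_bounded_cvg R nat U ultraU (fun m => y2 m i t) (C2 i).
    by move=> m; exact: y2M.
  by rewrite /phi2 (cvg_lim _ hl).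
have phi1C i t : `|phi1 i t| <= C1 i.
  apply: (cvg_le_bound _ (cvg_norm (y1phi i t))) => m.
  by have [_ _ _ _ h] := ysol m i; exact: h.
have phi2C i t : `|phi2 i t| <= C2 i.
  by apply: (cvg_le_bound _ (cvg_norm (y2phi i t))) => m; exact: y2M.
have phi2L i s t : `|phi2 i s - phi2 i t| <= L2 i * `|s - t|.
  by apply: (cvg_le_bound _ (cvg_norm (cvgB (y2phi i s) (y2phi i t)))) => m; exact: y2L.
have C2_ge0 i : 0 <= C2 i by exact: le_trans (normr_ge0 _) (y2M 0%N i 0).
have L2_ge0 i : 0 <= L2 i.
  by have := le_trans (normr_ge0 _) (phi2L i 1 0); rewrite subr0 normr1 mulr1.
have dphi i t : is_derive t 1 (phi i) (phi1 i t).
  apply: (@lipschitz_derive_limit R nat U _ (fun m => y m i) (fun m => y1 m i) _ _ (C2 i)) => //.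
    by move=> m; have [h _ _ _ _] := ysol m i.
  move=> m; have [_ dy1 _ _ _] := ysol m i.
  exact: derive_bounded_lipschitz dy1 (y2M m i).
have dphi1 i t : is_derive t 1 (phi1 i) (phi2 i t).
  apply: (@lipschitz_derive_limit R nat U _ (fun m => y1 m i) (fun m => y2 m i) _ _ (L2 i)) => //.
  by move=> m; have [_ h _ _ _] := ysol m i.
have between_phi : between phi.
  move=> i t; apply/andP; split; rewrite -lerN2.
    apply: (cvg_le_bound _ (cvgN (yphi i t))) => m; rewrite lerN2.
    by have /andP[] := solves_between (ysol m i) t.
  rewrite lerN2; apply: (cvg_le_bound _ (yphi i t)) => m.
  by have /andP[] := solves_between (ysol m i) t.
have psi_phi j t : psi m j t @[m --> U] --> phi j t.
  apply/cvgrPdist_le => e e0.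
  have e20 : 0 < e / 2 by rewrite divr_gt0.
  near=> m.
  have tm : `|t| <= m.+1%:R.
    rewrite -natr1 (le_trans (y := m%:R)) ?lerDl //.
    by near: m; exact: largeU.
  have h1 : (1 + 2 * L) / m.+1%:R <= e / 2.
    rewrite ler_pdivrMr ?ltr0n // [leRHS]mulrC -ler_pdivrMr // -[m.+1%:R]natr1.
    apply: (le_trans (y := m%:R)); last by rewrite lerDl.
    by near: m; exact: largeU.
  have h2 : `|phi j t - y m j t| <= e / 2.
    by near: m; exact: ((cvgrPdist_le _ _).1 (yphi j t) _ e20).
  have := le_trans (psiy m j t tm) h1; move: h2.
  rewrite !ler_norml => /andP[h2 h3] /andP[h4 h5].
  by apply/andP; split; lra.
have source_phi i t : source (psi m) i t @[m --> U] --> source phi i t.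
  apply/cvgrPdist_le => e e0.
  have kb : 0 < k + beta i by rewrite ltr_wpDl.
  have e20 : 0 < e / (k + beta i) by rewrite divr_gt0.
  have -> : e = (k + beta i) * (e / (k + beta i)) by rewrite mulrC divfK // gt_eqF.
  near=> m; apply: source_dist_le => j; apply: clip_dist_le.
    move: j; near: m; apply: filter_forall => j.
    exact: ((cvgrPdist_le _ _).1 (psi_phi j t) _ e20).
  move: j; near: m; apply: filter_forall => j.
  exact: ((cvgrPdist_le _ _).1 (psi_phi j (t - tau j)) _ e20).
exists phi, phi1, phi2; split=> //.
- by move=> i; exact: lipschitz_continuous (phi2L i).
- exists (\sum_i (`|C1 i| + C2 i)) => i t; rewrite (bigD1 i) //=.
  have S0 : 0 <= \sum_(j | j != i) (`|C1 j| + C2 j).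
    by rewrite sumr_ge0 // => j _; rewrite addr_ge0.
  have := phi1C i t; have := phi2C i t; have := C2_ge0 i.
  have := ler_norm (C1 i); have := normr_ge0 (C1 i).
  by move=> *; split; lra.
- move=> i t.
  have e1 : phi1 i t - D i * phi2 i t + beta i * phi i t = source phi i t.
    have l1 : y1 m i t - D i * y2 m i t + beta i * y m i t @[m --> U] -->
        phi1 i t - D i * phi2 i t + beta i * phi i t.
      apply: cvgD; last by apply: cvgM; [exact: cvg_cst | exact: yphi].
      by apply: cvgB; [exact: y1phi | apply: cvgM; [exact: cvg_cst | exact: y2phi]].
    have l2 : (fun m => y1 m i t - D i * y2 m i t + beta i * y m i t) =
        (fun m => source (psi m) i t).
      by apply/funext => m; have [_ _ h _ _] := ysol m i; exact: h.
    by rewrite l2 in l1; exact: (cvg_unique _ l1 (source_phi i t)).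
  by move: e1; rewrite /source clip_id //; exact: addIr.
Unshelve. all: by end_near. Qed.

End Existence.

(** * Row-valued functions *)

Section Rows.
Variables (R : realType) (n : nat).
Implicit Types (s t : R) (i j : 'I_n).

Lemma row_norm_le (x : 'rV[R]_n) (e : R) : 0 <= e -> (forall j, `|x 0 j| <= e) -> `|x| <= e.
Proof.
move=> e0 xe; rewrite /Num.Def.normr /= mx_normrE bigmax_le // => -[i j] _ /=.
by rewrite (ord1 i).
Qed.

Lemma row_entry_le (x : 'rV[R]_n) j : `|x 0 j| <= `|x|.
Proof.
rewrite [leRHS]/Num.Def.normr /= mx_normrE.
exact: (le_bigmax _ (fun ij => `|x ij.1 ij.2|) (0, j)).
Qed.

Lemma row_cvg (T : Type) (F : set_system T) (FF : Filter F)
    (g : 'I_n -> T -> R) (l : 'rV[R]_n) :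
  (forall j, g j x @[x --> F] --> l 0 j) -> (\row_j g j x) @[x --> F] --> l.
Proof.
move=> gl; apply/cvgrPdist_le => e e0; near=> x.
apply: row_norm_le => [|j]; first exact: ltW.
rewrite !mxE; move: j; near: x; apply: filter_forall => j.
exact: ((cvgrPdist_le _ _).1 (gl j) _ e0).
Unshelve. all: by end_near. Qed.

Lemma row_entry_cvg (T : Type) (F : set_system T) (FF : Filter F)
    (g : T -> 'rV[R]_n) (l : 'rV[R]_n) j :
  g x @[x --> F] --> l -> g x 0 j @[x --> F] --> l 0 j.
Proof.
move=> gl; apply/cvgrPdist_le => e e0; near=> x.
have : `|l - g x| <= e by near: x; exact: ((cvgrPdist_le _ _).1 gl _ e0).
by apply: le_trans; have := row_entry_le (l - g x) j; rewrite !mxE.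
Unshelve. all: by end_near. Qed.

Lemma row_is_derive (g g' : 'I_n -> R -> R) t : (forall j, is_derive t 1 (g j) (g' j t)) ->
  is_derive t 1 (fun s => \row_j g j s) (\row_j g' j t).
Proof.
move=> dg.
have dr : derivable (fun s => \row_j g j s) t 1.
  apply/derivable_mxP => i j.
  under eq_fun do rewrite mxE.
  by have [] := dg j.
apply: DeriveDef => //; rewrite derive_mx //; apply/rowP => j; rewrite !mxE.
under eq_fun do rewrite mxE.
by have [_ ->] := dg j.
Qed.

Lemma derivable_row_entry (phi : R -> 'rV[R]_n) t j : derivable phi t 1 ->
  is_derive t 1 (fun s => phi s 0 j) (derive1 phi t 0 j).
Proof.
move=> dphi; apply: DeriveDef; first by move/derivable_mxP: dphi; apply.
by rewrite derive1E derive_mx // mxE.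
Qed.

Lemma lipschitz_const (V W : normedModType R) (f : V -> W) : lipschitz f ->
  exists k : R, 0 <= k /\ forall x y, `|f x - f y| <= k * `|x - y|.
Proof.
move=> /pinfty_ex_gt0 [k k0 hk]; exists k; split; first exact: ltW.
by move=> x y; exact: (hk (x, y) (conj I I)).
Qed.

Lemma bounded_const (phi : R -> 'rV[R]_n) : bounded_fun phi ->
  exists M : R, forall t, `|phi t| <= M.
Proof. by move=> /pinfty_ex_gt0 [M _ hM]; exists M => t; exact: (hM t I). Qed.

Lemma bounded_fun_of_le (phi : R -> 'rV[R]_n) (M : R) : (forall t, `|phi t| <= M) ->
  bounded_fun phi.
Proof.
move=> h; rewrite /bounded_near; near=> N; move=> t _ /=; apply: le_trans (h t) _.
by near: N; apply: nbhs_pinfty_ge; exact: num_real.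
Unshelve. all: by end_near. Qed.

(** Mixed quasimonotonicity in one step: the four blocks are moved successively
    through intermediate points of the box. *)
Lemma quasimonotone_le (K : 'rV[R]_n) f (sp : splitting n) (i : 'I_n) (u u' v v' : 'rV[R]_n) :
  mixed_quasimonotone K f sp ->
  in_box K u -> in_box K u' -> in_box K v -> in_box K v' ->
  u 0 i = u' 0 i ->
  (forall j, j \in ublock_inc sp i -> u 0 j <= u' 0 j) ->
  (forall j, j \in ublock_dec sp i -> u' 0 j <= u 0 j) ->
  (forall j, j \in vblock_inc sp i -> v 0 j <= v' 0 j) ->
  (forall j, j \in vblock_dec sp i -> v' 0 j <= v 0 j) ->
  f (u, v) 0 i <= f (u', v') 0 i.
Proof.
move=> mqm bu bu' bv bv' ui uinc udec vinc vdec.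
have [h1 h2 h3 h4] := mqm i.
have box S x y : in_box K x -> in_box K y -> in_box K (override S x y).
  by move=> bx bY j; rewrite mxE; case: ifP.
have dis (A B : {set 'I_n}) j : A :&: B = finset.set0 -> j \in B -> j \in A = false.
  by move=> AB jB; move/setP: AB => /(_ j); rewrite !inE jB andbT.
pose w := override (ublock_inc sp i) u u'; pose z := override (vblock_inc sp i) v v'.
have bw : in_box K w by exact: box.
have bz : in_box K z by exact: box.
apply: (@le_trans _ _ (f (w, v) 0 i)).
  apply: h1 => //; split=> j jS; rewrite mxE; first by rewrite jS uinc.
  by rewrite (negbTE jS).
apply: (@le_trans _ _ (f (u', v) 0 i)).
  apply: h2 => //; split=> j jS; rewrite mxE.
    by rewrite (dis _ _ _ (ublock_disjoint sp i) jS) udec.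
  have := ublock_cover sp i j; rewrite (negbTE jS) orbF => ->.
  by case: eqVneq => [->|].
apply: (@le_trans _ _ (f (u', z) 0 i)).
  apply: h3 => //; split=> j jS; rewrite mxE; first by rewrite jS vinc.
  by rewrite (negbTE jS).
apply: h4 => //; split=> j jS; rewrite mxE.
  by rewrite (dis _ _ _ (vblock_disjoint sp i) jS) vdec.
by have := vblock_cover sp i j; rewrite (negbTE jS) orbF => ->.
Qed.

End Rows.

Lemma pair_norm_le (R : realType) (n : nat) (u u' v v' : 'rV[R]_n) (e : R) : 0 <= e ->
  (forall j, `|u 0 j - u' 0 j| <= e) -> (forall j, `|v 0 j - v' 0 j| <= e) ->
  `|(u, v) - (u', v')| <= e.
Proof.
move=> e0 ue ve; rewrite prod_normE /= ge_max.
by apply/andP; split; apply: row_norm_le => // j; rewrite !mxE.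
Qed.

(** * Traveling waves *)

(** The vector [override (ublock_dec s i) (up t) (lo t)] is the worst case for the
    upper inequality among arguments in the strip with [i]-th component [up t 0 i],
    by quasimonotonicity; symmetrically for the lower one.  This supplies the two
    bounds on the reaction term from which [profile_between_exists] starts. *)
Lemma component_profile_exists (R : realType) (n : nat)
  (d : 'rV[R]_n) (d_gt0 : forall i, 0 < d 0 i)
  (c : R) (c_gt0 : 0 < c) (tau K : 'rV[R]_n)
  (f : 'rV[R]_n * 'rV[R]_n -> 'rV[R]_n) (f_lipschitz : lipschitz f)
  (s : splitting n) (f_mqm : mixed_quasimonotone K f s)
  (up lo : R -> 'rV[R]_n) (up_box : Cb_box K up) (lo_box : Cb_box K lo)
  (up_lo : coupled_upper_lower d c tau f s up lo) :
  exists phi phi1 phi2 : 'I_n -> R -> R,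
  [/\ forall i (t : R), is_derive t 1 (phi i) (phi1 i t) /\ is_derive t 1 (phi1 i) (phi2 i t),
      forall i, continuous (phi2 i),
      exists C, forall i t, `|phi1 i t| <= C /\ `|phi2 i t| <= C,
      forall i t, phi1 i t - d 0 i / c ^+ 2 * phi2 i t =
         f (\row_j phi j t, \row_j phi j (t - tau 0 j)) 0 i
    & forall i t, lo t 0 i <= phi i t <= up t 0 i].
Proof.
have [k [k0 kf]] := lipschitz_const f_lipschitz.
have [[up_d up_b] [lo_d lo_b] lo_up up_ineq lo_ineq] := up_lo.
have [_ upK] := up_box; have [_ loK] := lo_box.
pose B : R := 1 + \sum_i `|K 0 i|.
have B0 : 0 < B by rewrite ltr_pwDl // sumr_ge0.
have KB i : K 0 i <= B.
  rewrite /B (bigD1 i) //=; have := ler_norm (K 0 i).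
  have : 0 <= \sum_(j | j != i) `|K 0 j| by rewrite sumr_ge0.
  lra.
have [Mu hMu] : exists M : R, forall t, `|derive1 up t| <= M.
  by apply: bounded_const; have [] := up_b 1%N isT.
have [Ml hMl] : exists M : R, forall t, `|derive1 lo t| <= M.
  by apply: bounded_const; have [] := lo_b 1%N isT.
pose M1 := Num.max Mu Ml.
have box_row (psi : 'I_n -> R -> R) (g : 'I_n -> R -> R) :
    (forall i t, lo t 0 i <= psi i t <= up t 0 i) -> forall t, in_box K (\row_j psi j (g j t)).
  move=> hpsi t j; rewrite mxE; have /andP[h1 h2] := hpsi j (g j t).
  have /andP[h3 _] := loK (g j t) j; have /andP[_ h4] := upK (g j t) j.
  by rewrite (le_trans h3) //= (le_trans h2).
have box_delay phi : (forall t, in_box K (phi t)) -> forall t, in_box K (delay tau phi t).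
  by move=> hphi t j; rewrite mxE; exact: hphi.
have box_override S x y : in_box K x -> in_box K y -> in_box K (override S x y).
  by move=> hx hy j; rewrite mxE; case: ifP.
have dec_self i : (i \in ublock_dec s i) = false.
  have := ublock_cover s i i; rewrite eqxx.
  by case: (i \in ublock_dec s i) => //; rewrite orbT.
have not_dec (A A' : {set 'I_n}) j : A :&: A' = finset.set0 -> j \in A -> j \in A' = false.
  by move=> AB jA; move/setP: AB => /(_ j); rewrite !inE jA.
have inc_neq i j : (j \in ublock_inc s i) -> (j == i) = false.
  by move=> ji; have := ublock_cover s i j; rewrite ji => /esym/negbTE.
have dec_neq i j : (j \in ublock_dec s i) -> (j == i) = false.
  by move=> ji; have := ublock_cover s i j; rewrite ji orbT => /esym/negbTE.
apply: (@profile_between_exists R 'I_n (fun i => d 0 i / c ^+ 2) (fun j => tau 0 j)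
  (fun i u v => f (\row_j u j, \row_j v j) 0 i) k B M1
  (fun i t => up t 0 i) (fun i t => derive1 up t 0 i) (fun i t => derive1n 2 up t 0 i)
  (fun i t => lo t 0 i) (fun i t => derive1 lo t 0 i) (fun i t => derive1n 2 lo t 0 i)) => //.
- by move=> i; rewrite divr_gt0 // exprn_gt0.
- move=> i u u' v v' e ue ve.
  have e0 : 0 <= e by exact: le_trans (normr_ge0 _) (ue i).
  apply: le_trans (_ : k * `|(\row_j u j, \row_j v j) - (\row_j u' j, \row_j v' j)| <= _).
    apply: le_trans (kf _ _).
    have := row_entry_le (f (\row_j u j, \row_j v j) - f (\row_j u' j, \row_j v' j)) i.
    by rewrite !mxE.
  by rewrite ler_wpM2l // pair_norm_le // => j; rewrite !mxE.
- by move=> i t; apply: derivable_row_entry; exact: (up_d 0%N).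
- by move=> i t; apply: derivable_row_entry; exact: (up_d 1%N).
- by move=> i t; apply: derivable_row_entry; exact: (lo_d 0%N).
- by move=> i t; apply: derivable_row_entry; exact: (lo_d 1%N).
- by move=> i t; rewrite (le_trans (row_entry_le _ _)) // le_max hMu.
- by move=> i t; rewrite (le_trans (row_entry_le _ _)) // le_max hMl orbT.
- by move=> i t; have /andP[] := loK t i.
- by move=> i t; have /andP[_ /le_trans] := upK t i; apply.
- move=> psi hpsi i t; apply: le_trans (up_ineq i t).
  apply: (quasimonotone_le f_mqm).
  + move=> j; rewrite mxE /replace_at; case: eqP => [->|_]; first exact: upK.
    by have := box_row psi (fun _ t => t) hpsi t j; rewrite mxE.
  + exact: box_override.
  + exact: (box_row psi (fun j t => t - tau 0 j)).
  + by apply: box_override; exact: box_delay.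
  + by rewrite !mxE /replace_at eqxx dec_self.
  + move=> j ji; rewrite !mxE /replace_at inc_neq // (not_dec _ _ _ (ublock_disjoint s i) ji).
    by have /andP[] := hpsi j t.
  + move=> j ji; rewrite !mxE /replace_at dec_neq // ji.
    by have /andP[] := hpsi j t.
  + move=> j ji; rewrite !mxE (not_dec _ _ _ (vblock_disjoint s i) ji).
    by have /andP[] := hpsi j (t - tau 0 j).
  + move=> j ji; rewrite !mxE ji.
    by have /andP[] := hpsi j (t - tau 0 j).
- move=> psi hpsi i t; apply: le_trans (lo_ineq i t) _.
  apply: (quasimonotone_le f_mqm).
  + exact: box_override.
  + move=> j; rewrite mxE /replace_at; case: eqP => [->|_]; first exact: loK.
    by have := box_row psi (fun _ t => t) hpsi t j; rewrite mxE.
  + by apply: box_override; exact: box_delay.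
  + exact: (box_row psi (fun j t => t - tau 0 j)).
  + by rewrite !mxE /replace_at eqxx dec_self.
  + move=> j ji; rewrite !mxE /replace_at inc_neq // (not_dec _ _ _ (ublock_disjoint s i) ji).
    by have /andP[] := hpsi j t.
  + move=> j ji; rewrite !mxE /replace_at dec_neq // ji.
    by have /andP[] := hpsi j t.
  + move=> j ji; rewrite !mxE (not_dec _ _ _ (vblock_disjoint s i) ji).
    by have /andP[] := hpsi j (t - tau 0 j).
  + move=> j ji; rewrite !mxE ji.
    by have /andP[] := hpsi j (t - tau 0 j).
Qed.

Lemma is_derive_affine (R : realType) (g : R -> R) (a b t dg : R) :
  is_derive (a * t + b) 1 g dg -> is_derive t 1 (fun s => g (a * s + b)) (a * dg).
Proof.
move=> hg; rewrite mulrC; apply: (is_derive1_comp (g := fun s => a * s + b)) => //.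
rewrite -[X in is_derive _ _ _ X]addr0 -[a in a + 0]mulr1.
exact: is_deriveD_fun.
Qed.

Lemma row_is_derive_affine (R : realType) (n : nat) (g g' : 'I_n -> R -> R) (a b : R) :
  (forall j (t : R), is_derive t 1 (g j) (g' j t)) -> forall t : R,
  is_derive t 1 (fun s => \row_j g j (a * s + b)) (a *: \row_j g' j (a * t + b)).
Proof.
move=> dg t.
have -> : a *: \row_j g' j (a * t + b) = \row_j (a * g' j (a * t + b)).
  by apply/rowP => j; rewrite !mxE.
exact: (@row_is_derive R n (fun j s => g j (a * s + b)) (fun j s => a * g' j (a * s + b)))
  (fun j => is_derive_affine (dg j _)).
Qed.

Theorem theorem2p1 (R : realType) (n : nat) (n_ge1 : (1 <= n)%N)
  (d : 'rV[R]_n) (d_gt0 : forall i, 0 < d 0 i)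
  (c : R) (c_gt0 : 0 < c)
  (tau : 'rV[R]_n) (tau_gt0 : forall i, 0 < tau 0 i)
  (K : 'rV[R]_n) (K_gt0 : forall i, 0 < K 0 i)
  (f : 'rV[R]_n * 'rV[R]_n -> 'rV[R]_n)
  (f_lipschitz : lipschitz f)
  (f00 : f (0, 0) = 0) (fKK : f (K, K) = 0)
  (f_C1 : C1 f)
  (s : splitting n) (f_mqm : mixed_quasimonotone K f s)
  (up lo : R -> 'rV[R]_n)
  (up_box : Cb_box K up) (lo_box : Cb_box K lo)
  (up_lo : coupled_upper_lower d c tau f s up lo)
  (up_lim : up t @[t --> -oo] --> (0 : 'rV[R]_n))
  (lo_lim : lo t @[t --> +oo] --> K) :
  exists phi : R -> 'rV[R]_n,
    traveling_wave_profile d c tau f K phi /\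
    pde_solution d tau f (fun x t => phi (t + x / c)).
Proof.
have [phi [phi1 [phi2 [dphi cphi2 [C hC] eq btw]]]] :=
  component_profile_exists d_gt0 c_gt0 f_lipschitz f_mqm up_box lo_box up_lo.
have [_ upK] := up_box; have [_ loK] := lo_box.
pose Phi t : 'rV[R]_n := \row_j phi j t.
pose Phi1 t : 'rV[R]_n := \row_j phi1 j t.
pose Phi2 t : 'rV[R]_n := \row_j phi2 j t.
have dPhi (t : R) : is_derive t 1 Phi (Phi1 t).
  by apply: row_is_derive => j; have [] := dphi j t.
have dPhi1 (t : R) : is_derive t 1 Phi1 (Phi2 t).
  by apply: row_is_derive => j; have [] := dphi j t.
have E1 : derive1 Phi = Phi1 by apply/funext => t; rewrite derive1E; have [_ ->] := dPhi t.
have E2 : derive1n 2 Phi = Phi2.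
  rewrite /derive1n /= E1; apply/funext => t; rewrite derive1E.
  by have [_ ->] := dPhi1 t.
have phiK j t : 0 <= phi j t <= K 0 j.
  have /andP[h1 h2] := btw j t; have /andP[h3 _] := loK t j; have /andP[_ h4] := upK t j.
  by rewrite (le_trans h3) // (le_trans h2).
have cont (g g' : R -> 'rV[R]_n) : (forall t : R, is_derive t 1 g (g' t)) -> continuous g.
  by move=> dg t; apply/differentiable_continuous/derivable1_diffP; have [] := dg t.
have C0 : 0 <= C by have [h _] := hC (Ordinal n_ge1) 0; exact: le_trans h.
have profile_eq t : Phi1 t - Phi2 t *m ((c ^+ 2)^-1 *: diag_mx d) = f (Phi t, delay tau Phi t).
  apply/rowP => i.
  have -> : delay tau Phi t = \row_j phi j (t - tau 0 j) by apply/rowP => j; rewrite !mxE.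
  rewrite -[RHS]eq -scalemxAr mul_mx_diag !mxE; congr (_ - _).
  by rewrite [LHS]mulrC -[LHS]mulrA [RHS]mulrC.
exists Phi; split; last first.
  move=> x t.
  have dt : is_derive t 1 (fun t => Phi (t + x / c)) (Phi1 (t + x / c)).
    have := row_is_derive_affine 1 (x / c) (fun j u => (dphi j u).1) t.
    by rewrite scale1r mul1r; under eq_fun do rewrite mul1r.
  have dx (y : R) : is_derive y 1 (fun x => Phi (t + x / c)) (c^-1 *: Phi1 (t + y / c)).
    have := row_is_derive_affine c^-1 t (fun j u => (dphi j u).1) y.
    by rewrite addrC mulrC; under eq_fun do rewrite addrC mulrC.
  have dxx (y : R) : is_derive y 1 (fun x => c^-1 *: Phi1 (t + x / c))
      ((c ^+ 2)^-1 *: Phi2 (t + y / c)).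
    have := is_deriveZ c^-1 (row_is_derive_affine c^-1 t (fun j u => (dphi j u).2) y).
    rewrite scalerA -invfM -expr2 addrC mulrC.
    by congr (is_derive _ _ _ _); apply/funext => z; rewrite /= addrC mulrC.
  have Ex : derive1 (fun x => Phi (t + x / c)) = (fun x => c^-1 *: Phi1 (t + x / c)).
    by apply/funext => y; rewrite derive1E; have [_ ->] := dx y.
  split.
  - by have [] := dt.
  - by have [] := dx x.
  - by rewrite Ex; have [] := dxx x.
  - rewrite /derive1n /= Ex !derive1E; have [_ ->] := dt; have [_ ->] := dxx x.
    rewrite -scalemxAl scalemxAr profile_eq; congr (f (_, _)).
    by apply/rowP => j; rewrite !mxE addrAC.
split.
- split=> [[|[|//]] _ t|[|[|[|//]]] _].
  + by have [] := dPhi t.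
  + by rewrite /derive1n /= E1; have [] := dPhi1 t.
  + split; first exact: cont dPhi.
    apply: (@bounded_fun_of_le _ _ _ `|K|) => t; apply: row_norm_le => // j; rewrite mxE.
    have /andP[h1 h2] := phiK j t; rewrite ger0_norm // (le_trans h2) //.
    by rewrite (le_trans (ler_norm _)) // row_entry_le.
  + rewrite /derive1n /= E1; split; first exact: cont dPhi1.
    apply: (@bounded_fun_of_le _ _ _ C) => t; apply: row_norm_le => // j.
    by rewrite mxE; have [] := hC j t.
  + rewrite E2; split; first by move=> t; apply: row_cvg => j; rewrite mxE; exact: cphi2.
    apply: (@bounded_fun_of_le _ _ _ C) => t; apply: row_norm_le => // j.
    by rewrite mxE; have [] := hC j t.
- by move=> t; rewrite E1 E2.
- apply: row_cvg => j; apply: (squeeze_cvgr (f := cst (0 : R)) (h := fun t => up t 0 j)).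
  + apply: nearW => t.
    by have /andP[-> _] := phiK j t; have /andP[] := btw j t.
  + by rewrite mxE; exact: cvg_cst.
  + exact: row_entry_cvg up_lim.
- apply: row_cvg => j; apply: (squeeze_cvgr (f := fun t => lo t 0 j) (h := cst (K 0 j))).
  + apply: nearW => t.
    by have /andP[_ ->] := phiK j t; have /andP[->] := btw j t.
  + exact: row_entry_cvg lo_lim.
  + exact: cvg_cst.
Qed.
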